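(* Let $\mathcal{C}_2(D,D')$ be the expanded code over $\mathbb{F}_2$ of the geometric Reed-Solomon code $\mathcal{C}(D,D')$ of length $\tilde n$ over $\mathbb{F}_q$, $q=2^s$, where $2g-2<\deg(D')<\tilde n$. Then $\mathcal{C}_2(D,D')$ has minimum distance $d\ge\tilde n-\deg(D')$. Furthermore, there exists an $l$-th order approximate ML decoding of $\mathcal{C}_2(D,D')$ with $l\ge\deg(D')-2g+1$ such that $$\tilde f_i(u)=u_i+f^{(l)}_i(v),\qquad i=1,\dots,n,\quad n=\tilde n s,$$ where $\tilde f$ is the $l$-th order Taylor truncation at $p=(1/2,\dots,1/2)$ of the rational map $f$ of the code $\mathcal{C}_2(D,D')$ and $v=u-p$.
   Context: Algebraic geometry codes. Let $q=2^s$, let $\mathcal{X}$ be an absolutely irreducible nonsingular projective curve over $\mathbb{F}_q$ of genus $g$, let $P_1,\dots,P_{\tilde n}$ be distinct rational points of $\mathcal{X}$, $D=P_1+\cdots+P_{\tilde n}$, and let $D'$ be a divisor on $\mathcal{X}$ whose support is disjoint from that of $D$, with $2g-2<\deg(D')<\tilde n$. Let $\mathcal{L}(D')=\{\phi\in\mathbb{F}_q(\mathcal{X})\setminus\{0\} : (\phi)+D'\ge0\}\cup\{0\}$, where $\mathbb{F}_q(\mathcal{X})$ is the function field and $(\phi)$ is the principal divisor of $\phi$. The geometric Reed-Solomon code $\mathcal{C}(D,D')\subset\mathbb{F}_q^{\tilde n}$ is the image of $\mathcal{L}(D')$ under $\phi\mapsto(\phi(P_1),\dots,\phi(P_{\tilde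 n}))$. Expanded codes. Fix a basis $e_1,\dots,e_s$ of $\mathbb{F}_q$ over $\mathbb{F}_2$. Replacing each coordinate of $x\in\mathbb{F}_q^{\tilde n}$ by its $s$ coefficients in this basis gives $\hat x\in\mathbb{F}_2^{\tilde n s}$. The expanded code of $\mathcal{C}_q\subset\mathbb{F}_q^{\tilde n}$ is $\{\hat x : x\in\mathcal{C}_q\}\subset\mathbb{F}_2^{\tilde n s}$. The minimum distance of a linear code is the minimal number of nonzero coordinates of a nonzero codeword. Rational map and approximate ML decoding. Binary linear codes are assumed throughout to have a generator matrix with linearly independent rows and with all columns nonzero. For such a code $\mathcal{C}\subset\mathbb{F}_2^n$ and $x\in\mathcal{C}$ let $F_x(u)=\prod_{i=1}^n\rho_i(u_i)$ with $\rho_i(u_i)=u_i$ if $x_i=1$ and $\rho_i(u_i)=1-u_i$ if $x_i=0$; let $H(u)=\sum_{x\in\mathcal{C}}F_x(u)$ and $f_i(u)=\big(\sum_{x\in\mathcal{C},x_i=1}F_x(u)\big)/H(u)$ for $u\in[0,1]^n$, $f=(f_1,\dots,f_n)$. With $p=(1/2,\dots,1/2)$ (a fixed point of $f$) and $v=u-p$, write the Taylor expansion $f(u)=p+Jv+f^{(2)}(v)+\cdots+f^{(l)}(v)+O(v^{l+1})$, where $J$ is the Jacobi matrix at $p$ and $f^{(j)}$ is the term of order $j$. Put $\tilde f(u)=p+Jv+f^{(2)}(v)+\cdots+f^{(l)}(v)$. The $l$-th order approximate ML (maximum likelihood) decoding, for a binary symmetric channel with transition probability $\epsilon\in(0,1/2)$,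 maps $y\in\mathbb{F}_2^n$ to $\tilde x\in\mathbb{F}_2^n$ with $\tilde x_i=1$ if $\tilde f_i(u^0)\ge1/2$ and $\tilde x_i=0$ if $\tilde f_i(u^0)<1/2$, where $u^0_i=\epsilon$ if $y_i=0$ and $u^0_i=1-\epsilon$ if $y_i=1$.
   Formalization: For the decoding claim, when deg(D') is at most 2g, it is additionally assumed that no two coordinates of C_2(D,D') agree on all codewords; otherwise J is not the identity and the formula fails for every l (e.g. g=0, D'=0, q=2, code {00,11}). *)

(* Defs.v *)
From HB Require Import structures.
From mathcomp Require Import all_boot all_order all_algebra all_field.
From mathcomp Require Import ring_quotient fraction.
From mathcomp Require Import mpoly freeg.
From mathcomp Require Import boolp reals topology normedtype derive.

Set Implicit Arguments.
Unset Strict Implicit.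
Unset Printing Implicit Defensive.

Import Order.TTheory GRing.Theory Num.Theory.
Import numFieldNormedType.Exports.

Local Open Scope ring_scope.

(* Projective varieties over a perfect field F (here F will be finite), in the
   classical language: iota embeds F in an algebraic closure K, points have
   coordinates in K, and a variety over F is the zero locus in P^N(K) of
   homogeneous polynomials with coefficients in F. *)
Section Variety.
Variables (F : fieldType) (K : closedFieldType) (iota : {rmorphism F -> K}).

(* A point of P^N(K) is represented by its unique homogeneous coordinate vector
   whose first nonzero entry is 1. *)
Definition normalized N (x : 'rV[K]_N.+1) : bool :=
  [exists i, (x 0 i == 1) && [forall j : 'I_N.+1, (j < i)%N ==> (x 0 j == 0)]].

Definition on_zero_locus N (eqs : seq {mpoly F[N.+1]}) (x : 'rV[K]_N.+1) : bool :=
  all (fun p => (map_mpoly iota p).@[x 0] == 0) eqs.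

(* Polynomials vanishing on the affine cone over the zero locus. As K is
   infinite, they form the ideal generated by the homogeneous polynomials
   vanishing on the zero locus. *)
Definition vanishing_ideal N (eqs : seq {mpoly F[N.+1]}) : {pred {mpoly K[N.+1]}} :=
  fun p => `[< forall x : 'rV[K]_N.+1, normalized x -> on_zero_locus eqs x ->
                 forall c : K, p.@[(c *: x) 0] = 0 >].

(* Primality is required over K, whence absolute irreducibility; 1 \notin I
   says that the zero locus is not empty. *)
Record variety := Variety {
  ambient : nat;
  equations : seq {mpoly F[ambient.+1]};
  equations_homog : forall p, p \in equations -> exists d, p \is d.-homog;
  ideal_proper : 1 \notin vanishing_ideal equations;
  ideal_prime : prime_idealr_closed (vanishing_ideal equations)
}.

Definition ideal (X : variety) : {pred {mpoly K[(ambient X).+1]}} :=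
  vanishing_ideal (equations X).
Arguments ideal : clear implicits.

Lemma ideal_closed X : idealr_closed (ideal X).
Proof.
split; [| exact: ideal_proper |].
  by apply/asboolP => x _ _ c; rewrite meval0.
move=> a u v /asboolP uI /asboolP vI; apply/asboolP => x nx zx c.
by rewrite mevalD mevalM uI // vI // mulr0 addr0.
Qed.

HB.instance Definition _ X := isIdealr.Build _ (ideal X) (ideal_closed X).
HB.instance Definition _ X :=
  isPrimeIdealrClosed.Build _ (ideal X) (@ideal_prime X).

(* The homogeneous coordinate ring K[X_0, ..., X_N] / I(X). *)
Definition coord_ring (X : variety) : Type := {ideal_quot (ideal X)}.
HB.instance Definition _ X := GRing.ComNzRing.on (coord_ring X).

Section CoordRingInverse.
Variable X : variety.

Definition coord_unit : {pred coord_ring X} := fun x => `[< exists y, y * x = 1 >].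

Definition coord_inv (x : coord_ring X) : coord_ring X :=
  if pselect (exists y, y * x = 1) is left h then projT1 (cid h) else x.

Lemma coord_mulVx : {in coord_unit, left_inverse 1 coord_inv *%R}.
Proof.
move=> x /asboolP ux; rewrite /coord_inv.
by case: pselect => // h; case: cid.
Qed.

Lemma coord_unitPl x y : y * x = 1 -> coord_unit x.
Proof. by move=> yx1; apply/asboolP; exists y. Qed.

Lemma coord_inv_out : {in [predC coord_unit], coord_inv =1 id}.
Proof.
move=> x /asboolPn nux; rewrite /coord_inv.
by case: pselect => // h; case: nux.
Qed.

End CoordRingInverse.

HB.instance Definition _ X := GRing.ComNzRing_hasMulInverse.Build (coord_ring X)
  (@coord_mulVx X) (@coord_unitPl X) (@coord_inv_out X).
HB.instance Definition _ X := GRing.ComUnitRing_isIntegral.Build (coord_ring X)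
  (@Quotient.rquot_IdomainAxiom _ (ideal X)).

Definition cone_field (X : variety) := {fraction (coord_ring X)}.

Section Points.
Variable X : variety.
Local Notation N := (ambient X).

Definition coord_class (a : {mpoly K[N.+1]}) : coord_ring X :=
  (\pi_{ideal_quot (ideal X)} a)%qT.

Definition fraction_of (a b : {mpoly K[N.+1]}) : cone_field X :=
  tofrac (coord_class a) / tofrac (coord_class b).

Definition constant (c : K) : cone_field X := tofrac (coord_class c%:MP).

Definition in_geometric_function_field (phi : cone_field X) : Prop :=
  exists d (a b : {mpoly K[N.+1]}),
    [/\ a \is d.-homog, b \is d.-homog, b \notin ideal X & phi = fraction_of a b].

Definition in_function_field (phi : cone_field X) : Prop :=
  exists d (a b : {mpoly F[N.+1]}),
    [/\ a \is d.-homog, b \is d.-homog, map_mpoly iota b \notin ideal X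
      & phi = fraction_of (map_mpoly iota a) (map_mpoly iota b)].

Definition algebraically_independent r (phi : 'I_r -> cone_field X) : Prop :=
  forall p : {mpoly K[r]}, (map_mpoly constant p).@[phi] = 0 -> p = 0.

(* The transcendence degree over K of the function field K(X) is r. *)
Definition has_dimension (r : nat) : Prop :=
  (exists phi : 'I_r -> cone_field X,
     (forall i, in_geometric_function_field (phi i)) /\
     algebraically_independent phi) /\
  (forall phi : 'I_r.+1 -> cone_field X,
     (forall i, in_geometric_function_field (phi i)) ->
     ~ algebraically_independent phi).

Definition point := {x : 'rV[K]_N.+1 | normalized x && on_zero_locus (equations X) x}.

Definition rational_point (P : point) : Prop :=
  exists x : 'rV[F]_N.+1, val P = map_mx iota x.

(* Jacobian criterion for a curve: at every point the gradients of the elements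
   of the ideal span a space of dimension N - 1. *)
Definition nonsingular_curve : Prop :=
  has_dimension 1 /\
  forall P : point, exists f : 'I_N.-1 -> {mpoly K[N.+1]},
    (forall i, f i \in ideal X) /\
    \rank (\matrix_(i, j) ((f i)^`M(j)).@[val P 0]) = N.-1.

(* phi is regular at P and phi(P) = c. *)
Definition has_value (P : point) (phi : cone_field X) (c : K) : Prop :=
  exists d (a b : {mpoly K[N.+1]}),
    [/\ a \is d.-homog, b \is d.-homog, b.@[val P 0] != 0,
        phi = fraction_of a b & c = a.@[val P 0] / b.@[val P 0]].

(* t generates the maximal ideal of the local ring at P. *)
Definition uniformizer (P : point) (t : cone_field X) : Prop :=
  has_value P t 0 /\
  forall phi, has_value P phi 0 ->
    exists psi c, has_value P psi c /\ phi = t * psi.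

Definition has_order (P : point) (phi : cone_field X) (n : int) : Prop :=
  exists t u c,
    [/\ uniformizer P t, has_value P u c, c != 0 & phi = t ^ n * u].

(* Divisors over K; those defined over F are the ones invariant under the
   automorphisms of K over F. The degree is [deg]. *)
Definition divisor := {freeg point / int}.

Definition rational_divisor (A : divisor) : Prop :=
  forall sigma : {rmorphism K -> K}, (forall a, sigma (iota a) = iota a) ->
  forall P Q : point, val Q = map_mx sigma (val P) -> coeff Q A = coeff P A.

Definition is_principal_divisor_of (phi : cone_field X) (A : divisor) : Prop :=
  forall P, has_order P phi (coeff P A).

Definition riemann_roch_space (A : divisor) (phi : cone_field X) : Prop :=
  in_function_field phi /\
  (phi = 0 \/
   exists B : divisor, is_principal_divisor_of phi B /\
     forall P, 0 <= coeff P (B + A)).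

(* V, an F-subspace of the function field, has dimension k over F. *)
Definition has_F_dim (V : cone_field X -> Prop) (k : nat) : Prop :=
  exists b : 'I_k -> cone_field X,
    [/\ forall i, V (b i),
        forall c : 'I_k -> F,
          \sum_i constant (iota (c i)) * b i = 0 -> forall i, c i = 0
      & forall phi, V phi ->
          exists c : 'I_k -> F, phi = \sum_i constant (iota (c i)) * b i].

(* The genus, defined as the maximum of deg A - dim L(A) + 1 over the divisors A
   defined over F. *)
Definition has_genus (g : nat) : Prop :=
  (exists A k, [/\ rational_divisor A, has_F_dim (riemann_roch_space A) k
                 & deg A - k%:Z + 1 = g%:Z]) /\
  (forall A k, rational_divisor A -> has_F_dim (riemann_roch_space A) k ->
     deg A - k%:Z + 1 <= g%:Z).

(* The points P i determine both the divisor D = sum_i P_i and the order of the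
   coordinates. *)
Definition geometric_RS_code m (P : 'I_m -> point) (A : divisor)
    (x : 'rV[F]_m) : Prop :=
  exists2 phi, riemann_roch_space A phi
             & forall i, has_value (P i) phi (iota (x 0 i)).

End Points.
End Variety.

Section BinaryCode.
Variable n : nat.
Implicit Type C : {set 'rV['F_2]_n}.

Definition weight (x : 'rV['F_2]_n) : nat := #|[set i | x 0 i != 0]|.

Definition is_min_distance C (d : nat) : Prop :=
  (exists x, [/\ x \in C, x != 0 & weight x = d]) /\
  (forall x, x \in C -> x != 0 -> (d <= weight x)%N).

Definition has_good_generator_matrix C : Prop :=
  exists k (G : 'M['F_2]_(k, n)),
    [/\ row_free G, forall j, col j G != 0 & forall x, (x \in C) = (x <= G)%MS].

(* The columns of a generator matrix are pairwise distinct. Otherwise the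
   linear part at p of the rational map below is not the identity. *)
Definition distinct_coordinates C : Prop :=
  forall i j : 'I_n, i != j -> exists2 x, x \in C & x 0 i != x 0 j.

End BinaryCode.

Section ExpandedCode.
Variables (s : nat) (F : fieldExtType 'F_2) (e : s.-tuple F).

Definition expand m (x : 'rV[F]_m) : 'rV['F_2]_(m * s) :=
  mxvec (\matrix_(i, j) coord e j (x 0 i)).

Definition expanded_code m (C : 'rV[F]_m -> Prop) : {set 'rV['F_2]_(m * s)} :=
  [set y | `[< exists2 x, C x & y = expand x >]].

End ExpandedCode.

Section RationalMap.
Variables (R : realType) (n : nat) (C : {set 'rV['F_2]_n}).
Implicit Types (u v : 'rV[R]_n) (x y : 'rV['F_2]_n).

Definition word_factor x u : R :=
  \prod_i (if x 0 i == 1 then u 0 i else 1 - u 0 i).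

Definition rational_map u : 'rV[R]_n :=
  \row_i ((\sum_(x in C | x 0 i == 1) word_factor x u) /
          (\sum_(x in C) word_factor x u)).

Definition center : 'rV[R]_n := const_mx 2^-1.

(* f^(j)(v), computed as the j-th Taylor coefficient at 0 of t |-> f(p + t v). *)
Definition taylor_term (j : nat) v : 'rV[R]_n :=
  \row_i ((j`!%:R)^-1 *
          derive1n j (fun t : R => rational_map (center + t *: v) 0 i) 0).

(* Vectors are rows, so J v is written v *m 'J f p. *)
Definition truncated_map (l : nat) u : 'rV[R]_n :=
  let v := u - center in
  center + v *m jacobian rational_map center + \sum_(2 <= j < l.+1) taylor_term j v.

Definition channel_input (eps : R) y : 'rV[R]_n :=
  \row_i (if y 0 i == 1 then 1 - eps else eps).

Definition is_approx_ML_decoding (l : nat) (eps : R)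
    (psi : 'rV['F_2]_n -> 'rV['F_2]_n) : Prop :=
  forall y i, psi y 0 i =
    if 2^-1 <= truncated_map l (channel_input eps y) 0 i then 1 else 0.

End RationalMap.

(* Main.v *)
From HB Require Import structures.
From mathcomp Require Import all_boot all_order all_algebra all_field.
From mathcomp Require Import ring_quotient fraction.
From mathcomp Require Import mpoly freeg.
From mathcomp Require Import boolp functions reals topology normedtype derive.
From mathcomp Require Import ring zify.
Require Import Defs.

Set Implicit Arguments.
Unset Strict Implicit.
Unset Printing Implicit Defensive.

Import Order.TTheory GRing.Theory Num.Theory.
Import numFieldNormedType.Exports.

Local Open Scope ring_scope.

(** Write $C$ for the geometric Reed-Solomon code, $L(A)$ for the Riemann-Roch
    space of a rational divisor $A$ and $l(A)$ for its dimension over $F$.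

    Both claims are about $L$. A function in $L(D')$ whose codeword vanishes at
    the points indexed by $Z$ lies in $L(D' - \sum_{i \in Z} P_i)$; a nonzero
    space has nonnegative degree, so the codeword has at most $\deg D'$ zeros
    ([evaluation_code_weight]), and each nonzero coordinate over $F$ contributes
    at least one nonzero bit. For the decoding map, the point is that any
    $t = \deg D' - 2g + 1$ coordinates of $C$, hence any $t$ bits of the expanded
    code, are independent ([expanded_strength]): if $\deg B \ge 2g - 1$ and $P$ is
    rational, some function in $L(B + P)$ is not in $L(B)$ ([rr_jump]).

    The genus is the maximum of $\deg A - l(A) + 1$, so Riemann's inequality
    holds by definition, and it gives the rest without duality. First, some
    $L(A)$ has finite dimension; so have all the $L(A + nP)$, which are not all
    zero by the inequality, and a nonzero element of one of them embeds $L(0)$ in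
    it. If $0 \ne \phi \in L(B)$ with $\deg B < 0$, multiplication by $\phi^n$
    embeds $L(-nB)$ in $L(0)$, while $l(-nB) \ge 1 - g - n \deg B$ is unbounded:
    hence $L(B) = 0$ ([rr_neg_deg]), and $L(0)$ consists of constants. Next
    suppose $L(A + P) = L(A)$. For no $j \ge 0$ do both $L(A - jP)$ and
    $L((j+1)P)$ strictly contain $L(A - (j+1)P)$ and $L(jP)$ respectively: the
    product of two witnesses would lie in $L(A + P)$ but not in $L(A)$. Counting
    jumps up to a large $n$ gives $l(A) + l(nP) \le n + 1$, so $l(A) \le g$; together with
    $l(A) = l(A + P) \ge \deg A + 2 - g$ this yields $\deg A \le 2g - 2$
    ([rr_no_jump_deg]).

    The geometry behind this is local. The Jacobian criterion makes the maximal
    ideal at each point principal ([local_parameter_exists]); since two functions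
    on a curve are algebraically dependent, every nonzero function has an order
    at each point ([regular_order]) and finitely many zeros and poles
    ([finite_zeros]). Values of $F$-rational functions at rational points lie in
    $F$ because they are fixed by the Frobenius map ([value_at_rational]), whence
    $l(A + P) \le l(A) + 1$.

    Finally, for a binary linear code let $f$ be its rational map. Along a line
    through $p$, numerator and denominator of $f_i$ are polynomials in the line
    variable, and the coefficients of the numerator of $f_i(u) - u_i$ are
    character sums over the code; those of degree less than $l$ vanish when no
    nonempty sum of at most $l$ coordinates is zero on the whole code
    ([line_num_dvd]). So $f_i(u) = u_i + O(v^l)$, the Jacobi matrix is the identity when $l \ge 2$, and
    only the term of order $l$ survives in the truncation ([truncated_mapE]).
    One takes $l = \max(2, t)$; when $t \le 1$ the distinctness of the coordinates
    replaces the geometric argument. *)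

(** * Polynomials in several variables *)

Section Polynomials.

Lemma mpoly_ring_ind (n : nat) (R : nzRingType) (T : {mpoly R[n]} -> Prop) :
  (forall c, T c%:MP) -> (forall i, T 'X_i) ->
  (forall p q, T p -> T q -> T (p + q)) ->
  (forall p q, T p -> T q -> T (p * q)) -> forall p, T p.
Proof.
move=> TC TX TD TM; elim/mpolyind=> [|c m p _ _ Tp]; first by rewrite -mpolyC0.
apply: (TD) => //; rewrite -mul_mpolyC; apply: (TM) => //.
rewrite mpolyXE_id; apply: big_ind => [||i _]; [by rewrite -mpolyC1 | exact: (TM) |].
by elim: (m i) => [|k IH]; rewrite ?expr0 -?mpolyC1 // exprS; apply: (TM).
Qed.

Lemma mmap_meval (n : nat) (R S : comNzRingType) (f : {rmorphism R -> S}) v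
    (p : {mpoly R[n]}) : (map_mpoly f p).@[v] = mmap f v p.
Proof.
elim/mpoly_ring_ind: p => [c|i|p q hp hq|p q hp hq].
- by rewrite map_mpolyC mevalC mmapC.
- by rewrite map_mpolyX mevalXU mmapX mmap1U.
- by rewrite rmorphD mevalD hp hq rmorphD.
- by rewrite rmorphM mevalM hp hq rmorphM.
Qed.

Lemma rmorph_mmap (n : nat) (R S T : comNzRingType) (f : {rmorphism R -> S})
    (h : {rmorphism S -> T}) v (p : {mpoly R[n]}) :
  h (mmap f v p) = mmap (h \o f) (h \o v) p.
Proof.
elim/mpoly_ring_ind: p => [c|i|p q hp hq|p q hp hq].
- by rewrite !mmapC.
- by rewrite !mmapX !mmap1U.
- by rewrite !rmorphD hp hq.
- by rewrite !rmorphM hp hq.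
Qed.

Lemma mmap_eq (n : nat) (R S : comNzRingType) (f g : R -> S) v w
    (p : {mpoly R[n]}) : f =1 g -> v =1 w -> mmap f v p = mmap g w p.
Proof.
move=> fg vw; rewrite /mmap; apply: eq_bigr => m _; rewrite fg; congr (_ * _).
exact: mmap1_eq.
Qed.

(** The coefficients are polynomials in the increments [y]: when the [y j] are
    functions vanishing at a point, the coefficients are functions whose values
    there are the partial derivatives. This is how gradients act on local rings. *)
Lemma mpoly_taylor1 (n : nat) (R : comNzRingType) (f : {mpoly R[n]}) (x : 'I_n -> R) :
  exists mu : 'I_n -> {mpoly R[n]},
    (forall j, (mu j).@[fun=> 0] = (f^`M(j)).@[x]) /\
    forall (S : comNzRingType) (g : {rmorphism R -> S}) (y : 'I_n -> S),
      mmap g (fun j => g (x j) + y j) f =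
      g f.@[x] + \sum_j mmap g y (mu j) * y j.
Proof.
elim/mpoly_ring_ind: f => [c|i|p q [mu [mu0 hp]] [nu [nu0 hq]]|
                          p q [mu [mu0 hp]] [nu [nu0 hq]]].
- exists (fun=> 0); split=> [j|S g y]; first by rewrite mderivC !meval0.
  by rewrite mmapC mevalC big1 ?addr0 // => j _; rewrite mmap0 mul0r.
- exists (fun j => if i == j then 1 else 0); split=> [j|S g y].
    rewrite mderivX mnm1E; case: eqP => [->|_]; last by rewrite scale0r !meval0.
    have -> : (U_(j) - U_(j))%MM = 0%MM :> 'X_{1..n}.
      by apply/mnmP => k; rewrite mnmBE subnn mnm0E.
    by rewrite scale1r mpolyX0 !meval1.
  rewrite mmapX mmap1U mevalXU; congr (_ + _); rewrite (bigD1 i) //= eqxx.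
  rewrite rmorph1 /= mul1r big1 ?addr0 // => j; rewrite eq_sym => /negbTE->.
  by rewrite rmorph0 mul0r.
- exists (fun j => mu j + nu j); split=> [j|S g y].
    by rewrite !(mevalD, mderivD) mu0 nu0.
  rewrite rmorphD /= hp hq mevalD rmorphD addrACA -big_split /=; congr (_ + _).
  by apply: eq_bigr => j _; rewrite rmorphD /= mulrDl.
- exists (fun j => mu j * (q.@[x]%:MP + \sum_k nu k * 'X_k) + p.@[x]%:MP * nu j).
  split=> [j|S g y].
    rewrite mderivM !(mevalD, mevalM) mu0 nu0 !mevalC.
    rewrite (raddf_sum (meval (fun=> 0))) [X in _ * (_ + X)]big1 ?addr0 // => k _.
    by rewrite /= mevalM mevalXU mulr0.
  rewrite rmorphM /= hp hq mevalM rmorphM mulrDl mulrDr -addrA; congr (_ + _).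
  set A := \sum_j _; set B := \sum_j _; set c := g _; set d := g _.
  (* the product of the two increments goes into the coefficients of mu *)
  have -> : c * A + B * (d + A) = B * (d + A) + c * A by rewrite addrC.
  rewrite mulr_suml mulr_sumr -big_split /=; apply: eq_bigr => j _.
  rewrite !(rmorphD, rmorphM) /= !mmapC rmorph_sum /=.
  rewrite (_ : \sum_k _ = A); last first.
    by apply: eq_bigr => k _; rewrite rmorphM /= mmapX mmap1U.
  by rewrite /c /d; ring.
Qed.

(** Euclidean division by the second variable: [q] is the restriction of [p] to
    the line where that variable vanishes. *)
Lemma mpoly2_split (R : comNzRingType) (p : {mpoly R[2]}) :
  exists (q : {poly R}) (p' : {mpoly R[2]}),
    p = (map_poly (@mpolyC 2 R) q).['X_0] + 'X_1 * p'.
Proof.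
elim/mpoly_ring_ind: p => [c|i|p q [p0 [p1 ->]] [q0 [q1 ->]]|
                          p q [p0 [p1 ->]] [q0 [q1 ->]]].
- by exists c%:P, 0; rewrite map_polyC hornerC mulr0 addr0.
- case: (unliftP 0 i) => [j|] ->.
    rewrite (ord1 j); exists 0, 1; rewrite map_poly0 horner0 add0r mulr1.
    by congr mpolyX; congr mnm1; apply: val_inj.
  by exists 'X, 0; rewrite map_polyX hornerX mulr0 addr0.
- exists (p0 + q0), (p1 + q1); rewrite rmorphD hornerD mulrDr.
  by rewrite addrACA.
- set P0 := horner _ _; set Q0 := horner _ _.
  exists (p0 * q0), (P0 * q1 + p1 * Q0 + 'X_1 * p1 * q1).
  by rewrite rmorphM hornerM -/P0 -/Q0; ring.
Qed.

Lemma closed_field_inf (K : closedFieldType) (n : nat) :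
  exists2 s : seq K, uniq s & size s = n.
Proof.
elim: n => [|n [s us <-]]; first by exists [::].
have: \prod_(a <- s) ('X - a%:P) != 0 by rewrite monic_neq0 // monic_prod_XsubC.
case/closed_nonrootP => a; rewrite root_prod_XsubC => nas.
by exists (a :: s) => //=; rewrite nas.
Qed.

(** A closed field is infinite, so it has enough constants to force the vanishing
    of a polynomial even when the coefficients lie in a larger field. *)
Lemma poly_vanish_eq0 (K : closedFieldType) (E : fieldType) (f : {rmorphism K -> E})
    (p : {poly E}) : (forall c, p.[f c] = 0) -> p = 0.
Proof.
move=> h; apply/eqP/contraT => nz.
have [s us ss] := closed_field_inf K (size p).
have /(max_poly_roots nz) : all (root p) (map f s).
  by rewrite all_map; apply/allP => c _ /=; apply/rootP.
rewrite map_inj_uniq ?us; last exact: fmorph_inj.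
by move/(_ isT); rewrite size_map ss ltnn.
Qed.

End Polynomials.

(** * Functions on a projective variety and their values *)

Section FunctionField.
Variables (F : fieldType) (K : closedFieldType) (iota : {rmorphism F -> K}).
Variable X : variety iota.
Local Notation N := (ambient X).
Local Notation IX := (@ideal _ _ _ X).
(** Of the fraction field of the homogeneous coordinate ring, only one property
    matters: it receives the polynomials by a ring morphism [cl] whose kernel is
    the ideal of [X]. The theory is developed over any such field [E]. *)
Variables (E : fieldType) (cl : {rmorphism {mpoly K[N.+1]} -> E}).

Definition geometric (phi : E) : Prop :=
  exists d (a b : {mpoly K[N.+1]}),
    [/\ a \is d.-homog, b \is d.-homog, b \notin IX & phi = cl a / cl b].

Definition rational (phi : E) : Prop :=
  exists d (a b : {mpoly F[N.+1]}),
    [/\ a \is d.-homog, b \is d.-homog, map_mpoly iota b \notin IX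
      & phi = cl (map_mpoly iota a) / cl (map_mpoly iota b)].

Definition value_at (P : point X) (phi : E) (c : K) : Prop :=
  exists d (a b : {mpoly K[N.+1]}),
    [/\ a \is d.-homog, b \is d.-homog, b.@[val P 0] != 0,
        phi = cl a / cl b & c = a.@[val P 0] / b.@[val P 0]].

Hypothesis clK : forall a, (cl a == 0) = (a \in IX).

Local Notation const := (cl \o @mpolyC N.+1 K).
Implicit Types (a b : {mpoly K[N.+1]}) (P : point X) (phi psi : E).

Lemma ideal_meval a x c : a \in IX -> normalized x ->
  on_zero_locus iota (equations X) x -> a.@[(c *: x) 0] = 0.
Proof. by move=> /asboolP aI nx zx; apply: aI. Qed.

Lemma ideal_vanish a P : a \in IX -> a.@[val P 0] = 0.
Proof.
by case: P => x /= /andP[nx zx] aI; rewrite -(scale1r x) (ideal_meval _ aI).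
Qed.

Lemma point_normalized P : normalized (val P).
Proof. by case/andP: (valP P). Qed.

Lemma point_on_locus P : on_zero_locus iota (equations X) (val P).
Proof. by case/andP: (valP P). Qed.

Lemma cl_neq0 b P : b.@[val P 0] != 0 -> cl b != 0.
Proof. by apply: contraNneq => /eqP; rewrite clK => /ideal_vanish->. Qed.

Lemma value_at_unique P phi c c' : value_at P phi c -> value_at P phi c' -> c = c'.
Proof.
move=> [d [a [b [_ _ bP -> ->]]]] [d' [a' [b' [_ _ b'P e ->]]]].
have /eqP : cl (a * b' - a' * b) = 0.
  have nb := cl_neq0 bP; have nb' := cl_neq0 b'P.
  by apply/eqP; rewrite rmorphB !rmorphM subr_eq0 -(eqr_div _ _ nb nb') e.
rewrite clK => /(ideal_vanish P) /eqP.
by rewrite mevalB !mevalM subr_eq0 => /eqP h; apply/eqP; rewrite eqr_div // h.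
Qed.

Lemma value_at_const P c : value_at P (const c) c.
Proof.
exists 0%N, c%:MP, 1; split; rewrite ?meval1 ?oner_eq0 ?mevalC ?divr1 //.
- by rewrite -(mulr1 c%:MP) mul_mpolyC dhomogZ // dhomog1.
- exact: dhomog1.
- by rewrite rmorph1 divr1.
Qed.

Lemma value_atD P phi psi c c' :
  value_at P phi c -> value_at P psi c' -> value_at P (phi + psi) (c + c').
Proof.
move=> [d [a [b [ha hb bP -> ->]]]] [d' [a' [b' [ha' hb' b'P -> ->]]]].
have nb := cl_neq0 bP; have nb' := cl_neq0 b'P.
exists (d + d')%N, (a * b' + a' * b), (b * b'); split.
- apply: rpredD; first exact: dhomogM.
  by rewrite addnC; apply: dhomogM.
- exact: dhomogM.
- by rewrite mevalM mulf_neq0.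
- by rewrite rmorphD !rmorphM addf_div.
- by rewrite mevalD !mevalM addf_div.
Qed.

Lemma value_atM P phi psi c c' :
  value_at P phi c -> value_at P psi c' -> value_at P (phi * psi) (c * c').
Proof.
move=> [d [a [b [ha hb bP -> ->]]]] [d' [a' [b' [ha' hb' b'P -> ->]]]].
exists (d + d')%N, (a * a'), (b * b'); split.
- exact: dhomogM.
- exact: dhomogM.
- by rewrite mevalM mulf_neq0.
- by rewrite !rmorphM mulf_div.
- by rewrite !mevalM mulf_div.
Qed.

Lemma value_atV P phi c : value_at P phi c -> c != 0 -> value_at P phi^-1 c^-1.
Proof.
move=> [d [a [b [ha hb bP -> ->]]]] nz.
exists d, b, a; split => //; rewrite ?invf_div //.
by apply: contraNneq nz => ->; rewrite mul0r.
Qed.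

Lemma value_at0 P : value_at P 0 0.
Proof. by have := value_at_const P 0; rewrite rmorph0. Qed.

Lemma value_at1 P : value_at P 1 1.
Proof. by have := value_at_const P 1; rewrite rmorph1. Qed.

Lemma value_at_neq0 P phi c : value_at P phi c -> c != 0 -> phi != 0.
Proof.
move=> h nz; apply: contra_neq nz => phi0; apply: value_at_unique h _.
by rewrite phi0; apply: value_at0.
Qed.

Lemma value_atN P phi c : value_at P phi c -> value_at P (- phi) (- c).
Proof. by move/(value_atM (value_at_const P (-1))); rewrite rmorphN1 !mulN1r. Qed.

Lemma value_atB P phi psi c c' :
  value_at P phi c -> value_at P psi c' -> value_at P (phi - psi) (c - c').
Proof. by move=> h /value_atN; apply: value_atD. Qed.

Lemma value_atX P phi c n : value_at P phi c -> value_at P (phi ^+ n) (c ^+ n).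
Proof.
move=> h; elim: n => [|n IH]; first by rewrite !expr0; apply: value_at1.
by rewrite !exprS; apply: value_atM.
Qed.

Lemma value_at_sum P (I : finType) (phi : I -> E) (c : I -> K) :
  (forall i, value_at P (phi i) (c i)) ->
  value_at P (\sum_i phi i) (\sum_i c i).
Proof.
move=> h; elim/big_rec2: _ => [|i x y _ IH]; first exact: value_at0.
exact: value_atD.
Qed.

Lemma value_at_prod P (I : finType) (phi : I -> E) (c : I -> K) :
  (forall i, value_at P (phi i) (c i)) ->
  value_at P (\prod_i phi i) (\prod_i c i).
Proof.
move=> h; elim/big_rec2: _ => [|i x y _ IH]; first exact: value_at1.
exact: value_atM.
Qed.

Lemma value_at_mmap P n (y : 'I_n -> E) c (p : {mpoly K[n]}) :
  (forall i, value_at P (y i) (c i)) -> value_at P (mmap const y p) p.@[c].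
Proof.
move=> h; elim/mpoly_ring_ind: p => [d|i|p q hp hq|p q hp hq].
- by rewrite mmapC mevalC; apply: value_at_const.
- by rewrite mmapX mmap1U mevalXU.
- by rewrite rmorphD mevalD; apply: value_atD.
- by rewrite rmorphM mevalM; apply: value_atM.
Qed.

Lemma value_at_horner P phi c (p : {poly K}) :
  value_at P phi c -> value_at P (map_poly const p).[phi] p.[c].
Proof.
move=> h; elim/poly_ind: p => [|p d IH].
  by rewrite map_poly0 !horner0; apply: value_at0.
rewrite rmorphD rmorphM /= map_polyX map_polyC !hornerMXaddC.
by apply: value_atD; [apply: value_atM | apply: value_at_const].
Qed.

Lemma value_at_geometric P phi c : value_at P phi c -> geometric phi.
Proof.
move=> [d [a [b [ha hb bP -> _]]]]; exists d, a, b; split => //.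
by rewrite -clK; apply: cl_neq0 bP.
Qed.

Lemma cl_mmap a : mmap const (fun j => cl 'X_j) a = cl a.
Proof.
elim/mpoly_ring_ind: a => [c|i|p q hp hq|p q hp hq].
- by rewrite mmapC.
- by rewrite mmapX mmap1U.
- by rewrite !rmorphD /= hp hq.
- by rewrite !rmorphM /= hp hq.
Qed.

Lemma cl_dehomog d a (l : E) : a \is d.-homog ->
  mmap const (fun j => cl 'X_j / l) a = cl a / l ^+ d.
Proof.
move=> ha; rewrite -cl_mmap /mmap mulr_suml big_seq [RHS]big_seq.
apply: eq_bigr => m ms; rewrite -mulrA; congr (_ * _).
rewrite -(dhomog_mf ha ms) /= mdegE /mmap1 -prodrXr -prodf_div.
by apply: eq_bigr => i _; rewrite expr_div_n.
Qed.

(** Elements of the ideal need not be homogeneous; it is the invariance of the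
    cone under infinitely many constant scalings that allows a scaling by an
    arbitrary function [l]. *)
Lemma ideal_dehomog a (l : E) : a \in IX ->
  mmap const (fun j => cl 'X_j / l) a = 0.
Proof.
move=> aI.
pose p := mmap (@polyC E \o const) (fun j => cl 'X_j *: 'X) a.
have pE x : p.[x] = mmap const (fun j => cl 'X_j * x) a.
  rewrite -[p.[x]]/(horner_eval x p) /p rmorph_mmap.
  by apply: mmap_eq => i /=; rewrite /horner_eval ?hornerC // hornerZ hornerX.
suff p0 : p = 0 by rewrite -pE p0 horner0.
apply: (poly_vanish_eq0 (f := const)) => c; rewrite pE.
pose ac := mmap (@mpolyC N.+1 K) (fun j => 'X_j * c%:MP) a.
have -> : mmap const (fun j => cl 'X_j * const c) a = cl ac.
  rewrite /ac rmorph_mmap; apply: mmap_eq => // i /=.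
  by rewrite rmorphM.
apply/eqP; rewrite clK; apply/asboolP => x nx zx c'.
rewrite /ac rmorph_mmap (mmap_eq (g := idfun) (w := (c * c' *: x) 0)).
- exact: (ideal_meval (c * c') aI nx zx).
- by move=> d /=; rewrite mevalC.
- by move=> i /=; rewrite mevalM mevalXU mevalC !mxE mulrC mulrA.
Qed.

Lemma point_coord1 P : exists i, (val P) 0 i = 1.
Proof. by case/existsP: (point_normalized P) => i /andP[/eqP h _]; exists i. Qed.

Lemma value_at_dehomog P d a i : a \is d.-homog -> (val P) 0 i = 1 ->
  value_at P (cl a / cl 'X_i ^+ d) a.@[val P 0].
Proof.
move=> ha Pi; exists d, a, ('X_i ^+ d); split => //.
- by rewrite -[d in d.-homog]mul1n; apply: dhomogMn; rewrite dhomogX /= mdeg1.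
- by rewrite rmorphXn /= mevalXU Pi expr1n oner_neq0.
- by rewrite rmorphXn.
- by rewrite rmorphXn /= mevalXU Pi expr1n divr1.
Qed.

Lemma cl_coord_neq0 P i : (val P) 0 i = 1 -> cl 'X_i != 0.
Proof. by move=> Pi; apply: (@cl_neq0 _ P); rewrite mevalXU Pi oner_eq0. Qed.

Lemma value_at_affine_coord P i j : (val P) 0 i = 1 ->
  value_at P (cl 'X_j / cl 'X_i) (val P 0 j).
Proof.
move=> Pi; have := value_at_dehomog (d := 1) (a := 'X_j) _ Pi.
by rewrite mevalXU expr1; apply; rewrite dhomogX /= mdeg1.
Qed.

Lemma affine_coord_geometric i j : cl 'X_i != 0 -> geometric (cl 'X_j / cl 'X_i).
Proof.
rewrite clK => nz; exists 1%N, 'X_j, 'X_i.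
by rewrite !dhomogX /= !mdeg1.
Qed.

Lemma geometric_quotient P phi : geometric phi ->
  exists alpha beta c d,
    [/\ value_at P alpha c, value_at P beta d, beta != 0 & phi = alpha / beta].
Proof.
move=> [d [a [b [ha hb bI ->]]]]; have [i Pi] := point_coord1 P.
have nXi := cl_coord_neq0 Pi.
exists (cl a / cl 'X_i ^+ d), (cl b / cl 'X_i ^+ d).
exists a.@[val P 0], b.@[val P 0]; split; try exact: value_at_dehomog.
  by rewrite mulf_neq0 ?clK // invr_eq0 expf_neq0.
by rewrite -mulf_div divff ?mulr1 // invr_eq0 expf_neq0.
Qed.

(** Two functions on a curve are algebraically dependent; isolating the terms
    of the relation free of [y] gives a form of it adapted to the study of the
    points where [y] vanishes. *)
Lemma algebraic_relation x y :
  (forall phi : 'I_2 -> E, (forall i, geometric (phi i)) ->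
     ~ forall p : {mpoly K[2]}, (map_mpoly const p).@[phi] = 0 -> p = 0) ->
  geometric x -> geometric y -> y != 0 ->
  exists (q : {poly K}) (r : {mpoly K[2]}), q != 0 /\
    (map_poly const q).[x] = y * mmap const (fun i => if i == 0 then x else y) r.
Proof.
move=> hdim gx gy ny; pose v (i : 'I_2) := if i == 0 then x else y.
have [p np pv] : exists2 p : {mpoly K[2]}, p != 0 & mmap const v p = 0.
  have gv i : geometric (v i) by rewrite /v; case: eqP.
  move: (hdim v gv); apply: contra_notP => h p; rewrite mmap_meval => pv.
  by apply/eqP/contraT => np; case: h; exists p.
elim: {p}(msize p) {-2}p (leqnn (msize p)) np pv => [p|n IH p].
  by rewrite leqn0 msize_poly_eq0 => /eqP-> /eqP.
move=> sp np pv; have [q [p' pE]] := mpoly2_split p.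
have vE : mmap const v p = (map_poly const q).[x] + y * mmap const v p'.
  rewrite {1}pE rmorphD rmorphM /= mmapX mmap1U /v /=; congr (_ + _).
  elim/poly_ind: (q) => [|q' c IHq]; first by rewrite !map_poly0 !horner0 rmorph0.
  rewrite !(rmorphD, rmorphM) /= !map_polyX !map_polyC !hornerMXaddC /=.
  by rewrite rmorphD rmorphM /= IHq mmapX mmap1U /= mmapC.
have [q0|nq] := eqVneq q 0; last first.
  exists q, (- p'); split => //; rewrite rmorphN mulrN.
  by apply/eqP; rewrite -addr_eq0 -vE pv.
have np' : p' != 0.
  by apply: contraNneq np => p'0; rewrite pE q0 p'0 map_poly0 horner0 mulr0 addr0.
apply: (IH p') => //.
- move: sp; rewrite pE q0 map_poly0 horner0 add0r msizeM ?msizeX ?mdeg1 //.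
  by rewrite -msize_poly_eq0 msizeX.
- by move: pv; rewrite vE q0 map_poly0 horner0 add0r => /eqP;
    rewrite mulf_eq0 (negbTE ny) => /eqP.
Qed.

End FunctionField.

(** * Local parameters from the Jacobian criterion *)

Section LocalParameters.
Variables (F : fieldType) (K : closedFieldType) (iota : {rmorphism F -> K}).
Variable X : variety iota.
Local Notation N := (ambient X).
Local Notation IX := (@ideal _ _ _ X).
Variables (E : fieldType) (cl : {rmorphism {mpoly K[N.+1]} -> E}).
Hypothesis clK : forall a, (cl a == 0) = (a \in IX).
Local Notation const := (cl \o @mpolyC N.+1 K).
Local Notation geometric := (geometric cl).
Local Notation value_at := (value_at cl).
Implicit Types (a b : {mpoly K[N.+1]}) (P : point X) (phi psi : E).

Definition local_parameter P (t : E) : Prop :=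
  value_at P t 0 /\
  forall phi, value_at P phi 0 ->
    exists psi c, value_at P psi c /\ phi = t * psi.

Definition order_at P phi (n : int) : Prop :=
  exists t u c,
    [/\ local_parameter P t, value_at P u c, c != 0 & phi = t ^ n * u].

Definition independent r (phi : 'I_r -> E) : Prop :=
  forall p : {mpoly K[r]}, (map_mpoly const p).@[phi] = 0 -> p = 0.

Definition dimension_is (r : nat) : Prop :=
  (exists phi : 'I_r -> E, (forall i, geometric (phi i)) /\ independent phi) /\
  (forall phi : 'I_r.+1 -> E, (forall i, geometric (phi i)) -> ~ independent phi).

Lemma value_mulmx P m n p (A : 'M[E]_(m, n)) (B : 'M[E]_(n, p)) (a : 'M[K]_(m, n))
    (b : 'M[K]_(n, p)) :
  (forall i j, value_at P (A i j) (a i j)) ->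
  (forall i j, value_at P (B i j) (b i j)) ->
  forall i j, value_at P ((A *m B) i j) ((a *m b) i j).
Proof.
move=> hA hB i j; rewrite !mxE; apply: (value_at_sum clK) => k; move: (hA i k) (hB k j).
by apply: value_atM.
Qed.

Lemma value_det P n (A : 'M[E]_n) (a : 'M[K]_n) :
  (forall i j, value_at P (A i j) (a i j)) -> value_at P (\det A) (\det a).
Proof.
move=> hA; apply: (value_at_sum clK) => s; apply: value_atM.
  rewrite -(rmorph_sign const); exact: value_at_const.
by apply: value_at_prod.
Qed.

Lemma value_adj P n (A : 'M[E]_n) (a : 'M[K]_n) :
  (forall i j, value_at P (A i j) (a i j)) ->
  forall i j, value_at P ((\adj A) i j) ((\adj a) i j).
Proof.
move=> hA i j; rewrite !mxE; apply: value_atM.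
  rewrite -(rmorph_sign const); exact: value_at_const.
by apply: value_det => k l; rewrite !mxE.
Qed.

(** Euler's relation, obtained from the vanishing of [a] on a line of the cone. *)
Lemma ideal_euler P a : a \in IX ->
  \sum_j val P 0 j * (a^`M(j)).@[val P 0] = 0.
Proof.
move=> aI; have [mu [mu0 hmu]] := mpoly_taylor1 a (val P 0).
set x := val P; pose y (j : 'I_N.+1) : {poly K} := x 0 j *: 'X.
have := hmu {poly K} (@polyC K) y.
rewrite (ideal_vanish P aI) rmorph0 add0r.
have -> : mmap (@polyC K) (fun j => (x 0 j)%:P + y j) a = 0.
  apply: (poly_vanish_eq0 (f := idfun)) => c /=.
  rewrite -[LHS]/(horner_eval c _) rmorph_mmap.
  rewrite (mmap_eq (g := idfun) (w := ((1 + c) *: x) 0)).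
  - exact: ideal_meval (point_normalized P) (point_on_locus P).
  - by move=> d /=; rewrite /horner_eval hornerC.
  - move=> j /=; rewrite /horner_eval hornerD hornerC hornerZ hornerX mxE.
    by rewrite mulrDl mul1r mulrC.
have -> : \sum_j mmap (@polyC K) y (mu j) * y j =
    (\sum_j x 0 j *: mmap (@polyC K) y (mu j)) * 'X.
  by rewrite mulr_suml; apply: eq_bigr => j _; rewrite /y -scalerAr scalerAl.
move/esym/eqP; rewrite mulf_eq0 polyX_eq0 orbF => /eqP/(congr1 (horner_eval 0)).
rewrite rmorph0 rmorph_sum /= => e; rewrite -[RHS]e; apply: eq_bigr => j _.
rewrite /horner_eval hornerZ -mu0; congr (_ * _).
rewrite -[RHS]/(horner_eval 0 _) rmorph_mmap; apply: mmap_eq => k /=.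
  by rewrite /horner_eval hornerC.
by rewrite /horner_eval hornerZ hornerX mulr0.
Qed.

Lemma row_full_extend m n (A : 'M[K]_(m, n)) : (n <= (\rank A).+1)%N ->
  exists w : 'rV[K]_n, (1%:M <= A + w)%MS.
Proof.
move=> rA; have [fA|] := boolP (1%:M <= A)%MS.
  by exists 0; apply: submx_trans fA (addsmxSl _ _).
case/row_subPn => i; set w := row i _ => wA; exists w.
rewrite sub1mx /row_full eqn_leq rank_leq_col /=; apply: leq_trans rA _.
rewrite (ltn_leqif (mxrank_leqif_sup (addsmxSl A w))).
by apply: contra wA; apply: submx_trans; apply: addsmxSr.
Qed.

(** The Jacobian criterion provides a local parameter: with [x] the coordinates
    of [P] and [x_i = 1], the functions [y_j = X_j / X_i - x_j] satisfy the
    linear relations given by the gradients (up to multiples of the [y_j] by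
    functions vanishing at [P]) and by [y_i = 0]. One more linear form [w] makes
    the system invertible, so every [y_j] is a multiple of [w.y]. *)
Lemma local_parameter_exists P :
  (exists f : 'I_N.-1 -> {mpoly K[N.+1]},
    (forall i, f i \in IX) /\
    \rank (\matrix_(i, j) ((f i)^`M(j)).@[val P 0]) = N.-1) ->
  exists t, local_parameter P t.
Proof.
move=> [f [fI]]; set J := (\matrix_(i, j) _) => rJ; set x := val P.
have [i Pi] := point_coord1 P; pose ei : 'rV[K]_N.+1 := delta_mx 0 i.
have Jx : J *m x^T = 0.
  apply/matrixP => k l; rewrite !mxE -[RHS](ideal_euler P (fI k)).
  by apply: eq_bigr => j _; rewrite !mxE mulrC (ord1 l).
have [w] : exists w : 'rV[K]_N.+1, (1%:M <= (J + ei)%MS + w)%MS.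
  apply: row_full_extend.
  suff lt_rank : (N.-1 < \rank (J + ei)%MS)%N by exact: leq_trans (leqSpred _) lt_rank.
  rewrite -[X in (X < _)%N]rJ (ltn_leqif (mxrank_leqif_sup (addsmxSl J ei))).
  apply/negP => /(submx_trans (addsmxSr J ei)) /submxP[z zE].
  have /matrixP/(_ 0 0) : ei *m x^T = 0 by rewrite zE -mulmxA Jx mulmx0.
  by rewrite -rowE !mxE Pi => /eqP; rewrite oner_eq0.
case/sub_addsmxP => -[B0 B3] /= e1.
have [[B1 B2] /= e2] : exists u, B0 *m (J + ei)%MS = u.1 *m J + u.2 *m ei.
  by apply/sub_addsmxP; apply: submxMl.
have e3 : 1%:M = B1 *m J + B2 *m ei + B3 *m w by rewrite -e2.
have nXi := cl_coord_neq0 clK Pi.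
pose yj j := cl 'X_j / cl 'X_i - const (x 0 j).
pose y : 'cV[E]_N.+1 := \col_j yj j.
have y0 j : value_at P (yj j) 0.
  have := value_atB clK (value_at_affine_coord cl j Pi) (value_at_const cl P (x 0 j)).
  by rewrite subrr.
have taylor a : exists2 mu : 'I_N.+1 -> E,
    (forall j, value_at P (mu j) (a^`M(j)).@[x 0]) &
    mmap const (fun j => cl 'X_j / cl 'X_i) a = const a.@[x 0] + \sum_j mu j * yj j.
  have [mu [mu0 hmu]] := mpoly_taylor1 a (x 0).
  exists (fun j => mmap const yj (mu j)).
    by move=> j; rewrite -mu0; apply: (value_at_mmap clK).
  rewrite -hmu; apply: mmap_eq => // j.
  by rewrite /yj addrCA subrr addr0.
have /choice[Aj hA] : forall k, exists A : 'I_N.+1 -> E,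
    (forall j, value_at P (A j) (J k j)) /\ \sum_j A j * yj j = 0.
  move=> k.
  have [mu hmu] := taylor (f k).
  rewrite (ideal_dehomog clK _ (fI k)) (ideal_vanish P (fI k)) rmorph0 add0r => e.
  by exists mu; split=> // j; rewrite mxE.
pose A : 'M[E]_(N.-1, N.+1) := \matrix_(k, j) Aj k j.
pose cst m n (M : 'M[K]_(m, n)) : 'M[E]_(m, n) := map_mx const M.
have vcst m n (M : 'M[K]_(m, n)) k j : value_at P (cst m n M k j) (M k j).
  by rewrite mxE; apply: value_at_const.
pose G := cst _ _ B1 *m A + cst _ _ B2 *m cst _ _ ei + cst _ _ B3 *m cst _ _ w.
pose t := (cst _ _ w *m y) 0 0.
have Ay : A *m y = 0.
  apply/matrixP => k l; rewrite !mxE -[RHS](hA k).2.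
  by apply: eq_bigr => j _; rewrite !mxE.
have ey : cst _ _ ei *m y = 0.
  apply/matrixP => k l; rewrite !mxE (bigD1 i) //= !mxE eqxx /yj divff //.
  rewrite Pi rmorph1 subrr mulr0 add0r big1 // => j /negbTE nij.
  by rewrite !mxE nij andbF rmorph0 mul0r.
have Gy : G *m y = t *: cst _ _ B3.
  rewrite !mulmxDl -!mulmxA Ay ey !mulmx0 !add0r.
  by rewrite [cst _ _ w *m y]mx11_scalar -/t mul_mx_scalar.
have vG k j : value_at P (G k j) ((1%:M : 'M[K]_N.+1) k j).
  rewrite e3 /G ![((_ + _) : 'M[_]_(_, _)) _ _]mxE.
  apply: (value_atD clK); first apply: (value_atD clK).
  - apply: value_mulmx => // k' j'; rewrite !mxE.
    by have := (hA k').1 j'; rewrite mxE.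
  - by apply: value_mulmx.
  - by apply: value_mulmx.
have vdet : value_at P (\det G) 1 by rewrite -(det1 K N.+1); apply: value_det.
have nG : \det G != 0 by apply: (value_at_neq0 clK vdet); rewrite oner_eq0.
pose rho j := (\adj G *m cst _ _ B3) j 0 / \det G.
have vrho j : exists c, value_at P (rho j) c.
  eexists; apply: value_atM; last first.
    by apply: (value_atV vdet); rewrite oner_eq0.
  apply: value_mulmx; last by move=> k l; apply: vcst.
  exact: (value_adj vG).
have yE j : yj j = t * rho j.
  have : \adj G *m (G *m y) = (\det G)%:M *m y by rewrite mulmxA mul_adj_mx.
  rewrite Gy -scalemxAr mul_scalar_mx => /matrixP/(_ j 0); rewrite !mxE => e.
  by rewrite /rho !mxE mulrA e mulrAC divff ?mul1r.
exists t; split.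
  have := @value_mulmx P _ _ _ (cst _ _ w) y w 0 _ _ 0 0.
  rewrite mulmx0 [X in value_at P _ X]mxE; apply => //.
  by move=> k l; rewrite !mxE.
move=> phi [d [a [b [ha hb bP -> e]]]].
have aP : a.@[x 0] = 0.
  by move/eqP: e; rewrite eq_sym mulf_eq0 invr_eq0 (negbTE bP) orbF => /eqP.
have [mu vmu muE] := taylor a.
have [c hc] := choice vrho.
exists ((\sum_j mu j * rho j) / (cl b / cl 'X_i ^+ d)).
eexists; split.
  apply: value_atM.
    by apply: (value_at_sum clK) => j; apply: value_atM.
  by apply: value_atV bP; apply: value_at_dehomog.
move: muE; rewrite aP rmorph0 add0r (cl_dehomog _ _ ha) mulrA => muE.
rewrite mulr_sumr; under eq_bigr => j _ do rewrite mulrCA -yE.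
by rewrite -muE invf_div mulrA divfK ?expf_neq0.
Qed.
End LocalParameters.

(** * Orders of functions, finiteness of zeros *)

Section Orders.
Variables (F : fieldType) (K : closedFieldType) (iota : {rmorphism F -> K}).
Variable X : variety iota.
Local Notation N := (ambient X).
Local Notation IX := (@ideal _ _ _ X).
Variables (E : fieldType) (cl : {rmorphism {mpoly K[N.+1]} -> E}).
Hypothesis clK : forall a, (cl a == 0) = (a \in IX).
Local Notation const := (cl \o @mpolyC N.+1 K).
Local Notation geometric := (geometric cl).
Local Notation value_at := (value_at cl).
Local Notation local_parameter := (local_parameter cl).
Local Notation order_at := (order_at cl).
Hypothesis hdim : dimension_is cl 1.
Hypothesis hparam : forall P, exists t, local_parameter P t.
Implicit Types (a b : {mpoly K[N.+1]}) (P : point X) (phi psi t : E).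

(** If the parameter were zero, functions regular at [P] would be constant, and
    so would be their quotients, that is all functions on [X]. *)
Lemma local_parameter_neq0 P t : local_parameter P t -> t != 0.
Proof.
case=> _ ht; apply/eqP => t0.
have reg_const phi c : value_at P phi c -> phi = const c.
  move=> h; have := value_atB clK h (value_at_const cl P c); rewrite subrr.
  by case/ht => psi [d [_ /eqP]]; rewrite t0 mul0r subr_eq0 => /eqP.
case: hdim => -[phi [gphi indep]] _.
have [alpha [beta [c [d [/reg_const ac /reg_const bd nb e]]]]] :=
  geometric_quotient clK P (gphi 0).
have : ('X_0 - (c / d)%:MP : {mpoly K[1]}) = 0.
  apply: indep; rewrite mmap_meval rmorphB /= mmapX mmap1U mmapC /= e ac bd.
  have nd : d != 0 by apply: contraNneq nb => d0; rewrite bd d0 rmorph0.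
  by rewrite -[cl (c / d)%:MP]/(const (c / d)) fmorph_div subrr.
move/(congr1 (meval (fun=> c / d + 1))); rewrite mevalB mevalXU mevalC meval0.
by rewrite addrC addKr => /eqP; rewrite oner_eq0.
Qed.

Lemma value_atXz P phi c (n : int) : c != 0 ->
  value_at P phi c -> value_at P (phi ^ n) (c ^ n).
Proof.
move=> nc h; case: n => n /=; first exact: value_atX.
by apply: value_atV; [apply: value_atX | rewrite expf_neq0].
Qed.

Lemma local_parameter_unit P t t' : local_parameter P t -> local_parameter P t' ->
  exists w e, [/\ value_at P w e, e != 0 & t' = t * w].
Proof.
move=> ht ht'; have nt := local_parameter_neq0 ht.
have [w [e [we t'E]]] := ht.2 _ ht'.1; have [v [d [vd tE]]] := ht'.2 _ ht.1.
exists w, e; split => //; apply/eqP => e0.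
have wv : w * v = 1 by apply: (mulfI nt); rewrite mulrA -t'E -tE mulr1.
have := value_atM we vd; rewrite wv e0 mul0r => h.
by have /eqP := value_at_unique clK h (value_at1 cl P); rewrite eq_sym oner_eq0.
Qed.

(** The number of factors [t] that can be extracted from [phi] is bounded because
    [phi] divides a nonzero polynomial in [t], whose order is its multiplicity
    at [0]; what remains is a unit. *)
Lemma regular_order P t phi c : local_parameter P t -> value_at P phi c -> phi != 0 ->
  exists (n : nat) u e, [/\ value_at P u e, e != 0 & phi = t ^+ n * u].
Proof.
move=> ht hphi nphi; have nt := local_parameter_neq0 ht.
have [q [r0 [nq qE]]] := algebraic_relation hdim.2 (value_at_geometric clK ht.1)
  (value_at_geometric clK hphi) nphi.
set r := mmap _ _ r0 in qE.
have hr : exists d, value_at P r d.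
  eexists; apply: (value_at_mmap clK (c := fun i => if i == 0 then 0 else c)) => i.
  by case: eqP => _; [apply: ht.1 | ].
have [k [q' nq' q'E]] := multiplicity_XsubC q 0; rewrite nq /= in nq'.
move: qE; rewrite q'E subr0 rmorphM rmorphXn /= map_polyX hornerM hornerXn.
have := value_at_horner clK q' ht.1; set u := horner _ t.
have : q'.[0] != 0 by [].
move: q'.[0] => e ne ue; rewrite mulrC => hE; clear q'E.
move: hr; elim: k phi r c hphi nphi hE => [|k IH] phi r c hphi nphi hE [d rd].
  exists 0%N, phi, c; split; rewrite ?mul1r //; apply: contraNneq ne => c0.
  rewrite expr0 mul1r in hE; have := value_atM hphi rd; rewrite -hE c0 mul0r.
  by move/(value_at_unique clK ue)->.
have [c0|nc] := eqVneq c 0; last by exists 0%N, phi, c; rewrite mul1r.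
rewrite c0 in hphi; have [psi [f [hpsi pE]]] := ht.2 _ hphi.
have npsi : psi != 0 by apply: contraNneq nphi => p0; rewrite pE p0 mulr0.
have [|n [u' [e' [hu' ne' psiE]]]] := IH psi r f hpsi npsi _ (ex_intro _ d rd).
  by apply: (mulfI nt); rewrite !mulrA -exprS hE pE.
by exists n.+1, u', e'; rewrite pE psiE exprS mulrA.
Qed.

Lemma order_exists P t phi : local_parameter P t -> geometric phi -> phi != 0 ->
  exists (n : int) u e, [/\ value_at P u e, e != 0 & phi = t ^ n * u].
Proof.
move=> ht gphi nphi; have nt := local_parameter_neq0 ht.
have [alpha [beta [c [d [ac bd nb e]]]]] := geometric_quotient clK P gphi.
have na : alpha != 0 by apply: contraNneq nphi => a0; rewrite e a0 mul0r.
have [n [u [f [hu nf aE]]]] := regular_order ht ac na.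
have [k [v [g [hv ng bE]]]] := regular_order ht bd nb.
exists (n%:Z - k%:Z), (u / v), (f / g); split.
- by apply: value_atM; last apply: value_atV.
- by rewrite mulf_neq0 ?invr_eq0.
- by rewrite e aE bE expfzDr // -invr_expz -!exprnP mulf_div.
Qed.

(** A pole of order at most [k], in a form that covers [phi = 0] and does not
    presuppose that [phi] has an order. *)
Definition bounded P phi (k : int) : Prop :=
  exists t c, local_parameter P t /\ value_at P (t ^ k * phi) c.

Lemma boundedE P t phi k : local_parameter P t ->
  bounded P phi k <-> exists c, value_at P (t ^ k * phi) c.
Proof.
move=> ht; split=> [[t' [c [ht' hc]]]|[c hc]]; last by exists t, c.
have [w [e [we ne ->]]] := local_parameter_unit ht' ht.
have nw := value_at_neq0 clK we ne; have nt' := local_parameter_neq0 ht'.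
exists (e ^ k * c); rewrite exprzMl ?unitfE //.
by rewrite -mulrA mulrCA; apply: value_atM; first exact: value_atXz.
Qed.

Lemma order_at_param P t phi n : local_parameter P t -> order_at P phi n ->
  exists u e, [/\ value_at P u e, e != 0 & phi = t ^ n * u].
Proof.
move=> ht [t' [u [c [ht' uc nc ->]]]].
have [w [e [we ne ->]]] := local_parameter_unit ht ht'.
have nw := value_at_neq0 clK we ne; have nt := local_parameter_neq0 ht.
exists (w ^ n * u), (e ^ n * c); split.
- by apply: value_atM; first exact: value_atXz.
- by rewrite mulf_neq0 // expfz_neq0.
- by rewrite exprzMl ?unitfE ?mulrA.
Qed.

Lemma order_at_bounded P phi n k : order_at P phi n -> bounded P phi k <-> 0 <= n + k.
Proof.
move=> on; have [t ht] := hparam P; have nt := local_parameter_neq0 ht.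
have [u [e [ue ne ->]]] := order_at_param ht on.
rewrite (boundedE _ _ ht) mulrA -expfzDr // addrC; case: (n + k) => j; split=> //.
  by move=> _; eexists; apply: value_atM ue; apply: value_atX ht.1.
case=> c; rewrite NegzE -invr_expz -exprnP => /(value_atM (value_atX j.+1 ht.1)).
rewrite mulrA divff ?expf_neq0 // mul1r exprS mul0r mul0r.
by move/(value_at_unique clK ue) => e0; rewrite e0 eqxx in ne.
Qed.

Lemma order_at_exists P phi : geometric phi -> phi != 0 -> exists n, order_at P phi n.
Proof.
move=> gphi nphi; have [t ht] := hparam P.
have [n [u [e [ue ne pE]]]] := order_exists ht gphi nphi.
by exists n, t, u, e.
Qed.

Lemma boundedD P phi psi k : bounded P phi k -> bounded P psi k -> bounded P (phi + psi) k.
Proof.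
have [t ht] := hparam P; rewrite !(boundedE _ _ ht) => -[c hc] [d hd].
by exists (c + d); rewrite mulrDr; apply: value_atD.
Qed.

Lemma boundedM P phi psi k l :
  bounded P phi k -> bounded P psi l -> bounded P (phi * psi) (k + l).
Proof.
have [t ht] := hparam P; rewrite !(boundedE _ _ ht) => -[c hc] [d hd].
have nt := local_parameter_neq0 ht.
by exists (c * d); rewrite expfzDr // mulrACA; apply: value_atM.
Qed.

Lemma bounded_leq P phi k l : k <= l -> bounded P phi k -> bounded P phi l.
Proof.
have [t ht] := hparam P; rewrite !(boundedE _ _ ht) => kl [c hc].
have nt := local_parameter_neq0 ht.
have [j ->] : exists j : nat, l = j%:Z + k.
  by exists `|l - k|%N; rewrite gez0_abs ?subr_ge0 // subrK.
by eexists; rewrite expfzDr // -mulrA; apply: value_atM hc; apply: value_atX ht.1.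
Qed.

Lemma bounded0E P phi : bounded P phi 0 <-> exists c, value_at P phi c.
Proof. by have [t ht] := hparam P; rewrite (boundedE _ _ ht) expr0z mul1r. Qed.

Lemma bounded_const P c : bounded P (const c) 0.
Proof. by apply/bounded0E; exists c; apply: value_at_const. Qed.

Lemma bounded_zero P k : bounded P 0 k.
Proof.
have [t ht] := hparam P; rewrite (boundedE _ _ ht) mulr0.
by exists 0; apply: value_at0.
Qed.

Lemma boundedN1E P phi : bounded P phi (-1) <-> value_at P phi 0.
Proof.
have [t ht] := hparam P; have nt := local_parameter_neq0 ht.
rewrite (boundedE _ _ ht) exprN1; split=> [[c hc]|/ht.2[psi [c [hc ->]]]].
  by have := value_atM ht.1 hc; rewrite mulVKf // mul0r.
by exists c; rewrite mulKf.
Qed.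

(** On the graded piece of functions of order at least [- k], ratios of elements
    of exact order [- k] are units, which makes the piece one-dimensional. *)
Lemma bounded_ratio P phi psi k : bounded P phi k -> bounded P psi k ->
  ~ bounded P phi (k - 1) ->
  exists2 c, value_at P (psi / phi) c &
    forall c', value_at P (psi / phi) c' -> bounded P (psi - const c' * phi) (k - 1).
Proof.
have [t ht] := hparam P; have nt := local_parameter_neq0 ht.
have lower chi : value_at P (t ^ k * chi) 0 -> bounded P chi (k - 1).
  move/boundedN1E; rewrite !(boundedE _ _ ht) => -[d].
  by rewrite mulrA -expfzDr // addrC => hd; exists d.
rewrite !(boundedE _ k ht) => -[c hc] [d hd] nphi.
have nc : c != 0 by apply/eqP => c0; apply: nphi; apply: lower; rewrite -c0.
have ratioE : psi / phi = (t ^ k * psi) / (t ^ k * phi).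
  by rewrite -mulf_div divff ?mul1r // expfz_neq0.
exists (d / c); first by rewrite ratioE; apply: value_atM hd _; apply: value_atV.
move=> c' hc'; apply: lower; rewrite mulrBr mulrCA.
have -> : 0 = d - c' * c.
  apply/esym/eqP; rewrite subr_eq0 -(divfK nc d); apply/eqP; congr (_ * _).
  apply: (value_at_unique clK _ hc'); rewrite ratioE.
  by apply: value_atM hd _; apply: value_atV.
by apply: (value_atB clK hd); apply: value_atM hc; apply: value_at_const.
Qed.

(** Each affine coordinate of a zero is a root of a polynomial that does not depend
    on the zero: the one of an algebraic relation between the coordinate and [b]. *)
Lemma finite_zeros d b : b \is d.-homog -> b \notin IX ->
  exists s : seq (point X), forall P, b.@[val P 0] = 0 -> P \in s.
Proof.
move=> hb bI.
have chart i j : exists L : seq K, forall P, val P 0 i = 1 -> b.@[val P 0] = 0 ->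
    val P 0 j \in L.
  have [Xi0|nXi] := eqVneq (cl 'X_i) 0.
    by exists [::] => P /(cl_coord_neq0 clK); rewrite Xi0 eqxx.
  have ny : cl b / cl 'X_i ^+ d != 0.
    by rewrite mulf_neq0 ?clK // invr_eq0 expf_neq0.
  have gy : geometric (cl b / cl 'X_i ^+ d).
    exists d, b, ('X_i ^+ d); split; rewrite -?clK ?rmorphXn ?expf_neq0 //.
    by rewrite -[d in d.-homog]mul1n; apply: dhomogMn; rewrite dhomogX /= mdeg1.
  have [q [r [nq qE]]] :=
    algebraic_relation hdim.2 (affine_coord_geometric clK j nXi) gy ny.
  have [L qL] := closed_field_poly_normal q; exists L => P Pi bP.
  have vx := value_at_affine_coord cl j Pi.
  have vy := value_at_dehomog cl hb Pi; rewrite bP in vy.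
  have := value_at_horner clK q vx; rewrite qE; set rr := mmap _ _ _ => hq.
  have [e hr] : exists e, value_at P rr e.
    eexists; apply: (value_at_mmap clK (c := fun k => if k == 0 then val P 0 j else 0)) => k.
    by case: eqP.
  have := value_at_unique clK hq (value_atM vy hr); rewrite mul0r => q0.
  have : root q (val P 0 j) by apply/rootP.
  by rewrite qL rootZ ?lead_coef_eq0 // root_prod_XsubC.
have /choice[L hL] : forall i, exists L : 'I_N.+1 -> seq K, forall j P,
    val P 0 i = 1 -> b.@[val P 0] = 0 -> val P 0 j \in L j.
  by move=> i; have /choice[L hL] := chart i; exists L => j P; apply: hL.
pose M := flatten [seq L ij.1 ij.2 | ij : 'I_N.+1 * 'I_N.+1].
pose rows := [seq (\row_j val (f j) : 'rV[K]_N.+1) | f : {ffun 'I_N.+1 -> seq_sub M}].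
exists (pmap insub rows) => P bP; have [i Pi] := point_coord1 P.
have PM j : val P 0 j \in M.
  apply/flattenP; exists (L i j); last exact: hL.
  by apply/mapP; exists (i, j); rewrite ?mem_enum.
rewrite mem_pmap_sub; apply/mapP.
exists [ffun j => SeqSub (PM j)]; first by rewrite mem_enum.
by apply/rowP => j; rewrite mxE ffunE.
Qed.

Lemma order_at_finite phi : geometric phi -> phi != 0 ->
  exists s : seq (point X), forall P, P \notin s -> order_at P phi 0.
Proof.
move=> [d [a [b [ha hb bI ->]]]] nphi.
have aI : a \notin IX.
  by rewrite -clK; apply: contraNneq nphi => ->; rewrite mul0r.
have [s1 h1] := finite_zeros ha aI; have [s2 h2] := finite_zeros hb bI.
exists (s1 ++ s2) => P; rewrite mem_cat negb_or => /andP[P1 P2].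
have na : a.@[val P 0] != 0 by apply: contraNneq P1 => /h1.
have nb : b.@[val P 0] != 0 by apply: contraNneq P2 => /h2.
have [t ht] := hparam P.
exists t, (cl a / cl b), (a.@[val P 0] / b.@[val P 0]); split=> //.
- by exists d, a, b.
- by rewrite mulf_neq0 ?invr_eq0.
- by rewrite expr0z mul1r.
Qed.

End Orders.

(** * Values at rational points *)

Section Descent.
Variables (F : fieldType) (K : closedFieldType) (iota : {rmorphism F -> K}).
Variable X : variety iota.
Local Notation N := (ambient X).
Local Notation IX := (@ideal _ _ _ X).
Variables (E : fieldType) (cl : {rmorphism {mpoly K[N.+1]} -> E}).
Hypothesis clK : forall a, (cl a == 0) = (a \in IX).
Variable sigma : {rmorphism K -> K}.
Hypothesis sigma_iota : forall a, sigma (iota a) = iota a.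
Hypothesis sigma_onto : forall c, exists c', sigma c' = c.
Hypothesis sigma_fixed : forall c, sigma c = c -> exists d, c = iota d.

Lemma map_mpoly_fixed n (p : {mpoly F[n]}) :
  map_mpoly sigma (map_mpoly iota p) = map_mpoly iota p.
Proof. by apply/mpolyP => m; rewrite !mcoeff_map_mpoly /= sigma_iota. Qed.

Lemma meval_conj n (p : {mpoly K[n]}) v w : w =1 sigma \o v ->
  (map_mpoly sigma p).@[w] = sigma p.@[v].
Proof. by move=> wE; rewrite mmap_meval /meval rmorph_mmap; apply: mmap_eq. Qed.

Lemma map_mpoly_homog n d (p : {mpoly K[n]}) :
  p \is d.-homog -> map_mpoly sigma p \is d.-homog.
Proof.
move=> hp; apply/dhomogP => m.
rewrite (perm_mem (msupp_map_mpoly p (fmorph_inj sigma))).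
exact: (dhomog_mf hp).
Qed.

(** The equations have coefficients in [F], so [sigma] maps points to points; it
    reaches all of them because it is onto [K]. *)
Lemma ideal_conj a : a \in IX -> map_mpoly sigma a \in IX.
Proof.
move=> aI; apply/asboolP => x nx zx c.
have [tau tauK] : exists tau : K -> K, forall d, sigma (tau d) = d.
  by have /choice[tau ?] := sigma_onto; exists tau.
pose x' : 'rV[K]_N.+1 := map_mx tau x.
have sx' j : sigma (x' 0 j) = x 0 j by rewrite mxE tauK.
rewrite (@meval_conj _ a ((tau c *: x') 0)); last first.
  by move=> j /=; rewrite !mxE rmorphM /= !tauK.
rewrite (ideal_meval _ aI) ?rmorph0 //.
  case/existsP: nx => i /andP[xi /forallP xj]; apply/existsP; exists i.
  rewrite -(inj_eq (fmorph_inj sigma)) sx' rmorph1 xi /=.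
  apply/forallP => j; apply/implyP => ji.
  by rewrite -(fmorph_eq0 sigma) sx' (implyP (xj j) ji).
apply/allP => p pX; rewrite -(fmorph_eq0 sigma) -(@meval_conj _ _ _ (x 0)).
  by rewrite map_mpoly_fixed; exact: (allP zx p pX).
by move=> j; rewrite /= sx'.
Qed.

(** A quotient representing [phi] near [P] need not have coefficients in [F]. Its
    conjugate still represents [phi], and [P] is fixed, so the value is fixed. *)
Lemma value_at_rational P phi c : rational_point P -> rational cl phi ->
  value_at cl P phi c -> exists d, c = iota d.
Proof.
move=> [x Px] [d [a [b [ha hb bI phiE]]]] h; apply: sigma_fixed.
apply: (value_at_unique clK _ h); move: h => [e [a' [b' [ha' hb' b'P phiE' ->]]]].
have sP : val P 0 =1 sigma \o val P 0 by move=> j /=; rewrite Px mxE sigma_iota.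
have sb'P : (map_mpoly sigma b').@[val P 0] != 0.
  by rewrite (meval_conj _ sP) fmorph_eq0.
exists e, (map_mpoly sigma a'), (map_mpoly sigma b'); split=> //.
- exact: map_mpoly_homog.
- exact: map_mpoly_homog.
- have nb : cl (map_mpoly iota b) != 0 by rewrite clK.
  rewrite phiE; apply/eqP; rewrite eqr_div ?(cl_neq0 clK sb'P) // -subr_eq0.
  rewrite -!rmorphM -rmorphB clK -(map_mpoly_fixed a) -(map_mpoly_fixed b).
  rewrite -!rmorphM -rmorphB; apply: ideal_conj; rewrite -clK rmorphB !rmorphM subr_eq0.
  by rewrite -eqr_div ?(cl_neq0 clK b'P) // -phiE phiE'.
- by rewrite !(meval_conj _ sP) -fmorph_div.
Qed.

End Descent.

Section Frobenius.
Variables (F : fieldExtType 'F_2) (K : closedFieldType) (iota : {rmorphism F -> K}).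

(** The [q]-th power map with [q = #|F|]: its fixed points are the roots of
    [X^q - X], which are the [q] elements of [F]. *)
Lemma frobenius_exists : exists sigma : {rmorphism K -> K},
  [/\ forall a, sigma (iota a) = iota a, forall c, exists c', sigma c' = c
    & forall c, sigma c = c -> exists d, c = iota d].
Proof.
pose q := #|finvect_type F|.
have char2 : 2%N \in GRing.pchar K.
  apply: (rmorph_pchar iota); apply: (rmorph_pchar (in_alg F)).
  exact: pchar_Fp.
have [k q2] : exists k, q = (2 ^ k)%N.
  exists (\dim {: finvect_type F}%VS); have := card_vspace {: finvect_type F}%VS.
  by rewrite card_Fp // card_vspacef.
have qchar : (GRing.pchar K).-nat q.
  by rewrite (eq_pnat _ (pcharf_eq char2)) q2 pnatX pnat_id.
have q0 : (0 < q)%N by rewrite q2 expn_gt0.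
pose f (x : K) := x ^+ q.
have fB : zmod_morphism f.
  by move=> x y; rewrite /f (GRing.exprDn_pchar _ _ qchar) (GRing.exprNn_pchar _ qchar).
have fM : monoid_morphism f by split=> [|x y]; rewrite /f ?expr1n // exprMn.
pose mZ := GRing.isZmodMorphism.Build _ _ f fB.
pose mM := GRing.isMonoidMorphism.Build _ _ f fM.
pose sigma : {rmorphism K -> K} := HB.pack f mZ mM.
exists sigma; split=> [a|c|c].
- have aq : a ^+ q = a := expf_card (a : finvect_type F).
  by rewrite /= /f -(rmorphXn iota) aq.
- have /closed_rootP[c' /rootP c'E] : size ('X^q - c%:P : {poly K}) != 1%N.
    by rewrite size_XnsubC // eqSS -lt0n.
  exists c'; apply/eqP; rewrite /= /f -subr_eq0 -[X in _ - X](hornerC c c').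
  by rewrite -hornerXn -hornerN -hornerD c'E.
- move=> /eqP fc; have := congr1 (map_poly iota) (finField_genPoly (finvect_type F)).
  rewrite rmorphB /= map_polyXn map_polyX rmorph_prod => /(congr1 (horner_eval c)).
  rewrite /horner_eval hornerD hornerN hornerXn hornerX horner_prod.
  have -> : c ^+ #|finvect_type F| - c = 0 by apply/eqP; rewrite subr_eq0.
  move/esym/eqP; rewrite prodf_seq_eq0 => /hasP[d _] /=.
  by rewrite map_polyXsubC hornerXsubC subr_eq0 => /eqP->; exists d.
Qed.

End Frobenius.

(** * Riemann-Roch spaces *)

Section FiniteDimension.
Variables (F E : fieldType) (k : {rmorphism F -> E}).
Implicit Types (V W : E -> Prop).

Definition free_family n (b : 'I_n -> E) : Prop :=
  forall c : 'I_n -> F, \sum_i k (c i) * b i = 0 -> forall i, c i = 0.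

Definition F_dim V (n : nat) : Prop :=
  exists b : 'I_n -> E,
    [/\ forall i, V (b i), free_family b
      & forall phi, V phi -> exists c : 'I_n -> F, phi = \sum_i k (c i) * b i].

Definition F_subspace V : Prop :=
  V 0 /\ forall c x y, V x -> V y -> V (k c * x + y).

Lemma F_subspace_sum V n (b : 'I_n -> E) (c : 'I_n -> F) :
  F_subspace V -> (forall i, V (b i)) -> V (\sum_i k (c i) * b i).
Proof. by case=> V0 VD Vb; elim/big_rec: _ => // i x _; apply: VD. Qed.

Lemma F_dim_ext V W n : (forall x, V x <-> W x) -> F_dim V n -> F_dim W n.
Proof.
move=> VW [b [Vb fb gb]]; exists b; split=> // [i|x /VW]; first exact/VW.
exact: gb.
Qed.

Lemma free_family_leq W n m (b : 'I_m -> E) :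
  F_dim W n -> free_family b -> (forall i, W (b i)) -> (m <= n)%N.
Proof.
move=> [w [_ _ gw]] fb Wb; have /choice[A bE] := fun i => gw _ (Wb i).
rewrite leqNgt; apply/negP => nm; pose M := \matrix_(i, j) A i j.
have : kermx M != 0.
  by rewrite kermx_eq0 /row_free neq_ltn (leq_ltn_trans (rank_leq_col M)).
case/rowV0Pn => c /sub_kermxP cM /rV0Pn[i nci]; case/eqP: nci.
apply: (fb (fun i => c 0 i)); under eq_bigr => l _ do rewrite bE mulr_sumr.
rewrite exchange_big big1 //= => j _.
have e : \sum_l k (c 0 l) * k (A l j) = 0.
  have /matrixP/(_ 0 j) := cM; rewrite !mxE => /(congr1 k).
  rewrite rmorph0 rmorph_sum => h; rewrite -[RHS]h; apply: eq_bigr => l _.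
  by rewrite mxE rmorphM.
under eq_bigr => l _ do rewrite mulrA.
by rewrite -mulr_suml e mul0r.
Qed.

Lemma F_dim_unique V n m : F_dim V n -> F_dim V m -> n = m.
Proof.
move=> dn dm; apply/eqP; rewrite eqn_leq.
have [b [Vb fb _]] := dn; have [c [Vc fc _]] := dm.
by rewrite (free_family_leq dm fb Vb) (free_family_leq dn fc Vc).
Qed.

Lemma F_dim_zero V : V 0 -> (forall x, V x -> x = 0) -> F_dim V 0.
Proof.
move=> V0 Vz; exists (fun=> 0); split=> // [c _ []//|x /Vz->].
by exists (fun=> 0); rewrite big_ord0.
Qed.

Lemma F_dim_le V n : F_subspace V ->
  (forall m (b : 'I_m -> E), free_family b -> (forall i, V (b i)) -> (m <= n)%N) ->
  exists2 m, (m <= n)%N & F_dim V m.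
Proof.
move=> [V0 VD] hn.
pose T m := `[< exists b : 'I_m -> E, free_family b /\ forall i, V (b i)>].
have T0 : exists m, T m.
  by exists 0%N; apply/asboolP; exists (fun=> 0); split=> [c _ []//|[]].
have Tn m : T m -> (m <= n)%N by move=> /asboolP[b [fb Vb]]; apply: hn fb Vb.
case: (ex_maxnP T0 Tn) => m /asboolP[b [fb Vb]] maxm.
exists m; first by apply: hn fb Vb.
exists b; split=> // x Vx; apply: contrapT => nx.
suff : T m.+1 by move/maxm; rewrite ltnn.
apply/asboolP; exists (fun i => oapp b x (unlift 0 i)); split; last first.
  by move=> i; case: unliftP => [j|] _ //=; apply: Vb.
move=> c; rewrite big_ord_recl unlift_none /=.
under eq_bigr => j _ do rewrite liftK /=.
have [c0|nc0] := eqVneq (c 0) 0.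
  rewrite c0 rmorph0 mul0r add0r => /fb hc i.
  by case: (unliftP 0 i) => [j|] -> //; rewrite hc.
move/eqP; rewrite addrC addr_eq0 => /eqP e; case: nx.
exists (fun j => - (c 0)^-1 * c (fintype.lift ord0 j)).
under eq_bigr => j _ do rewrite rmorphM -mulrA.
by rewrite -mulr_sumr e rmorphN fmorphV mulrNN mulKf // fmorph_eq0.
Qed.

Lemma F_dim_mul V W n psi : F_subspace V -> F_dim W n -> psi != 0 ->
  (forall x, V x -> W (psi * x)) -> exists2 m, (m <= n)%N & F_dim V m.
Proof.
move=> sV dW npsi VW; apply: F_dim_le => // m b fb Vb.
apply: (free_family_leq (b := fun i => psi * b i) dW) => [c|i]; last exact/VW.
under eq_bigr => i _ do rewrite mulrCA.
by rewrite -mulr_sumr => /eqP; rewrite mulf_eq0 (negbTE npsi) => /eqP /fb.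
Qed.

Lemma F_dimS V W n phi : F_subspace V -> F_subspace W -> F_dim V n ->
  (forall x, V x -> W x) -> W phi -> ~ V phi ->
  (forall x, W x -> exists c, V (x - k c * phi)) -> F_dim W n.+1.
Proof.
move=> sV sW [b [Vb fb gb]] VW Wphi nphi dec.
exists (fun i => oapp b phi (unlift 0 i)); split.
- by move=> i; case: unliftP => [j|] _ //=; apply: VW.
- move=> c; rewrite big_ord_recl unlift_none /=.
  under eq_bigr => j _ do rewrite liftK /=.
  have [c0|nc0] := eqVneq (c 0) 0.
    rewrite c0 rmorph0 mul0r add0r => /fb hc i.
    by case: (unliftP 0 i) => [j|] -> //; rewrite hc.
  move/eqP; rewrite addr_eq0 => /eqP e; case: nphi.
  have -> : phi = k (- (c 0)^-1) * (\sum_i k (c (fintype.lift ord0 i)) * b i) + 0.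
    by rewrite addr0 rmorphN mulNr -mulrN -e fmorphV mulKf // fmorph_eq0.
  by apply: sV.2 sV.1; apply: F_subspace_sum.
- move=> x /dec[c0 /gb[c e]].
  exists (fun i => oapp c c0 (unlift 0 i)); rewrite big_ord_recl unlift_none /=.
  under eq_bigr => j _ do rewrite liftK /=.
  by rewrite -e addrC subrK.
Qed.

End FiniteDimension.

Section RiemannRoch.
Variables (F : fieldType) (K : closedFieldType) (iota : {rmorphism F -> K}).
Variable X : variety iota.
Local Notation N := (ambient X).
Local Notation IX := (@ideal _ _ _ X).
Variables (E : fieldType) (cl : {rmorphism {mpoly K[N.+1]} -> E}).
Hypothesis clK : forall a, (cl a == 0) = (a \in IX).
Local Notation const := (cl \o @mpolyC N.+1 K).
Local Notation geometric := (geometric cl).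
Local Notation rational := (rational cl).
Local Notation value_at := (value_at cl).
Local Notation bounded := (bounded cl).
Local Notation order_at := (order_at cl).
Local Notation F_dim := (F_dim (const \o iota)).
Local Notation F_subspace := (F_subspace (const \o iota)).
Hypothesis hdim : dimension_is cl 1.
Hypothesis hparam : forall P, exists t, local_parameter cl P t.
Hypothesis hrat : forall P phi c, rational_point P -> rational phi ->
  value_at P phi c -> exists d, c = iota d.
Implicit Types (P : point X) (A B : divisor X) (phi psi : E).

Definition rr_space A phi : Prop :=
  rational phi /\
  (phi = 0 \/
   exists B : divisor X, (forall P, order_at P phi (coeff P B)) /\
     forall P, 0 <= coeff P (B + A)).

Definition genus_is (g : nat) : Prop :=
  (exists A n, [/\ rational_divisor A, F_dim (rr_space A) n
                 & deg A - n%:Z + 1 = g%:Z]) /\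
  (forall A n, rational_divisor A -> F_dim (rr_space A) n ->
     deg A - n%:Z + 1 <= g%:Z).

Lemma rational_geometric phi : rational phi -> geometric phi.
Proof.
have map_homog d (a : {mpoly F[N.+1]}) : a \is d.-homog -> map_mpoly iota a \is d.-homog.
  move=> ha; apply/dhomogP => m.
  rewrite (perm_mem (msupp_map_mpoly a (fmorph_inj iota))).
  exact: (dhomog_mf ha).
move=> [d [a [b [ha hb bI ->]]]].
by exists d, (map_mpoly iota a), (map_mpoly iota b); split=> //; apply: map_homog.
Qed.

Lemma rational_const c : rational (const (iota c)).
Proof.
exists 0%N, c%:MP, 1; split.
- by rewrite -(mulr1 c%:MP) mul_mpolyC dhomogZ // dhomog1.
- exact: dhomog1.
- by rewrite rmorph1; apply: ideal_proper.
- by rewrite !rmorph1 divr1 map_mpolyC.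
Qed.

Lemma rationalD phi psi : rational phi -> rational psi -> rational (phi + psi).
Proof.
move=> [d [a [b [ha hb bI ->]]]] [d' [a' [b' [ha' hb' bI' ->]]]].
have nb : cl (map_mpoly iota b) != 0 by rewrite clK bI.
have nb' : cl (map_mpoly iota b') != 0 by rewrite clK bI'.
exists (d + d')%N, (a * b' + a' * b), (b * b'); split.
- apply: rpredD; first exact: dhomogM.
  by rewrite addnC; apply: dhomogM.
- exact: dhomogM.
- by rewrite (rmorphM (map_mpoly iota)) -clK (rmorphM cl) (mulf_neq0 nb nb').
- rewrite (rmorphD (map_mpoly iota)) !(rmorphM (map_mpoly iota)).
  by rewrite (rmorphD cl) !(rmorphM cl) (addf_div _ _ nb nb').
Qed.

Lemma rationalM phi psi : rational phi -> rational psi -> rational (phi * psi).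
Proof.
move=> [d [a [b [ha hb bI ->]]]] [d' [a' [b' [ha' hb' bI' ->]]]].
have nb : cl (map_mpoly iota b) != 0 by rewrite clK bI.
have nb' : cl (map_mpoly iota b') != 0 by rewrite clK bI'.
exists (d + d')%N, (a * a'), (b * b'); split.
- exact: dhomogM.
- exact: dhomogM.
- by rewrite (rmorphM (map_mpoly iota)) -clK (rmorphM cl) (mulf_neq0 nb nb').
- by rewrite !(rmorphM (map_mpoly iota)) !(rmorphM cl) mulf_div.
Qed.

Lemma rational0 : rational 0.
Proof. by have := rational_const 0; rewrite !rmorph0. Qed.

Lemma rational1 : rational 1.
Proof. by have := rational_const 1; rewrite !rmorph1. Qed.

Lemma rationalV phi : rational phi -> rational phi^-1.
Proof.
have [->|nphi] := eqVneq phi 0; first by rewrite invr0.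
move=> [d [a [b [ha hb bI e]]]]; exists d, b, a.
have na : cl (map_mpoly iota a) != 0.
  by apply: contraNneq nphi => a0; rewrite e a0 mul0r.
by split; [exact: hb | exact: ha | rewrite -clK na | rewrite e invf_div].
Qed.

(** Local bounds in place of a divisor of [phi]: in this form the space is visibly
    closed under sums. *)
Definition rr A phi : Prop := rational phi /\ forall P, bounded P phi (coeff P A).

(** The finiteness of the set of zeros and poles assembles the local orders of
    a nonzero function into a divisor. *)
Lemma rr_spaceE A phi : rr_space A phi <-> rr A phi.
Proof.
split=> -[rphi h]; split=> //.
  case: h => [-> P|[B [oB BA]] P]; first exact: bounded_zero.
  by apply/(order_at_bounded clK hdim hparam _ (oB P)); rewrite -coeffD.
have [->|nphi] := eqVneq phi 0; [by left|right].
have gphi := rational_geometric rphi.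
have /choice[n on] : forall P, exists n, order_at P phi n.
  by move=> P; exact: (order_at_exists clK hdim hparam P gphi nphi).
have [s hs] := order_at_finite clK hdim hparam gphi nphi.
pose B : divisor X := \sum_(P <- undup s) << n P *g P >>.
have cB P : coeff P B = if P \in s then n P else 0.
  rewrite raddf_sum /= (eq_bigr (fun Q => if Q == P then n P else 0)); last first.
    by move=> Q _; rewrite coeffU; case: eqP => [->|]; rewrite ?mulr1 ?mulr0.
  case: ifP => Ps.
    by rewrite (bigD1_seq P) ?mem_undup ?undup_uniq //= eqxx big1 ?addr0 // => Q /negbTE->.
  by rewrite big_seq big1 // => Q; rewrite mem_undup; case: eqP => // ->; rewrite Ps.
exists B; split=> P.
  by rewrite cB; case: ifP => [_|/negbT/hs].
rewrite coeffD cB; case: ifP => [_|/negbT Ps].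
  exact/(order_at_bounded clK hdim hparam _ (on P)).
exact/(order_at_bounded clK hdim hparam _ (hs P Ps)).
Qed.

Lemma rr_subspace A : F_subspace (rr A).
Proof.
split=> [|c x y [rx bx] [ry by_]].
  by split=> [|P]; [exact: rational0 | exact: bounded_zero].
split=> [|P]; first by apply: rationalD ry; apply: rationalM rx; apply: rational_const.
apply: (boundedD clK hdim hparam) (by_ P); rewrite -[coeff P A]add0r.
by apply: (boundedM clK hdim hparam) (bx P); apply: bounded_const.
Qed.

Lemma rrM A B phi psi : rr A phi -> rr B psi -> rr (A + B) (phi * psi).
Proof.
move=> [r1 b1] [r2 b2]; split=> [|P]; first exact: rationalM.
by rewrite coeffD; apply: (boundedM clK hdim hparam).
Qed.

Lemma rr_sub A B phi : (forall P, coeff P A <= coeff P B) -> rr A phi -> rr B phi.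
Proof.
by move=> AB [r b]; split=> // P; apply: (bounded_leq clK hdim hparam) (AB P) (b P).
Qed.

Lemma rr1 : rr 0 1.
Proof.
split=> [|P]; first exact: rational1.
by have := bounded_const clK hdim hparam P 1; rewrite rmorph1 coeff0.
Qed.

Lemma rrX A phi n : rr A phi -> rr (A *+ n) (phi ^+ n).
Proof.
move=> h; elim: n => [|n IH]; first by rewrite mulr0n expr0; apply: rr1.
by rewrite mulrS exprS; apply: rrM.
Qed.

Section RationalPoint.
Variable P : point X.
Hypothesis ratP : rational_point P.
Local Notation PD := (<< P >> : divisor X).

Lemma coeff_point Q : coeff Q PD = (P == Q)%:R.
Proof. by rewrite coeffU mul1r. Qed.

Lemma rr_succ A phi : rr A phi -> rr (A + PD) phi.
Proof. by apply: rr_sub => Q; rewrite coeffD lerDl coeff_point ler0n. Qed.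

Lemma rr_succP A phi : rr (A + PD) phi -> bounded P phi (coeff P A) -> rr A phi.
Proof.
move=> [r b] bP; split; first exact: r.
move=> Q; have [<-|nQ] := eqVneq P Q; first exact: bP.
by have := b Q; rewrite coeffD coeff_point (negbTE nQ) addr0.
Qed.

Lemma rr_succ_dec A phi : rr (A + PD) phi -> ~ rr A phi ->
  forall psi, rr (A + PD) psi -> exists c, rr A (psi - const (iota c) * phi).
Proof.
move=> hphi nphi psi hpsi; have cP : coeff P (A + PD) = coeff P A + 1.
  by rewrite coeffD coeff_point eqxx.
have nb : ~ bounded P phi (coeff P A + 1 - 1).
  by rewrite addrK => b; apply: nphi; apply: rr_succP.
have := hphi.2 P; have := hpsi.2 P; rewrite cP => bpsi bphi.
have [e he hc] := bounded_ratio clK hdim hparam bphi bpsi nb.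
have [c ce] := hrat ratP (rationalM hpsi.1 (rationalV hphi.1)) he.
exists c; apply: rr_succP; last by rewrite -ce -[coeff P A](addrK 1); apply: hc.
have -> : psi - const (iota c) * phi = (const \o iota) (- c) * phi + psi.
  by rewrite rmorphN mulNr addrC.
exact: (rr_subspace (A + PD)).2.
Qed.

Lemma rr_succ_dim A n : F_dim (rr A) n ->
  (F_dim (rr (A + PD)) n /\ forall phi, rr (A + PD) phi -> rr A phi) \/
  (F_dim (rr (A + PD)) n.+1 /\ exists2 phi, rr (A + PD) phi & ~ rr A phi).
Proof.
move=> dA; have [[phi hphi nphi]|h] := pselect (exists2 phi, rr (A + PD) phi & ~ rr A phi).
  right; split; last by exists phi.
  exact: (F_dimS (rr_subspace A) (rr_subspace (A + PD)) dA (@rr_succ A) hphi nphi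
    (rr_succ_dec hphi nphi)).
left; have sub phi : rr (A + PD) phi -> rr A phi.
  by move=> hphi; apply: contrapT => nphi; apply: h; exists phi.
by split=> //; apply: F_dim_ext dA => x; split; [apply: rr_succ | apply: sub].
Qed.

Lemma rr_add_dim A n k : F_dim (rr A) n -> exists n', F_dim (rr (A + PD *+ k)) n'.
Proof.
move=> dA; elim: k => [|k [n' IH]]; first by exists n; rewrite mulr0n addr0.
rewrite mulrSr addrA; case: (rr_succ_dim IH) => [[d _]|[d _]]; by [exists n'|exists n'.+1].
Qed.

Lemma rational_divisorD A B : rational_divisor A -> rational_divisor B ->
  rational_divisor (A + B).
Proof. by move=> rA rB s sF Q Q' e; rewrite !coeffD (rA s sF Q Q' e) (rB s sF Q Q' e). Qed.

Lemma rational_divisorN A : rational_divisor A -> rational_divisor (- A).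
Proof. by move=> rA s sF Q Q' e; rewrite !coeffN (rA s sF Q Q' e). Qed.

Lemma rational_divisorMn A n : rational_divisor A -> rational_divisor (A *+ n).
Proof. by move=> rA s sF Q Q' e; rewrite !coeffMn (rA s sF Q Q' e). Qed.

Lemma rational_divisor0 : rational_divisor (0 : divisor X).
Proof. by move=> s sF Q Q' e; rewrite !coeff0. Qed.

Lemma rational_divisor_point : rational_divisor PD.
Proof.
move=> s sF Q Q' e; rewrite !coeff_point; congr (nat_of_bool _)%:R.
have [x Px] := ratP; have sP : map_mx s (val P) = val P.
  by apply/rowP => j; rewrite Px !mxE sF.
apply/eqP/eqP => PQ; apply: val_inj; last by rewrite e -PQ sP.
by apply: (map_mx_inj (f := s)); rewrite -e sP PQ.
Qed.

Lemma order_atM Q phi psi n n' :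
  order_at Q phi n -> order_at Q psi n' -> order_at Q (phi * psi) (n + n').
Proof.
move=> on on'; have [t ht] := hparam Q.
have [u [c [uc nc ->]]] := order_at_param clK hdim ht on.
have [v [d [vd nd ->]]] := order_at_param clK hdim ht on'.
exists t, (u * v), (c * d); split=> //; first exact: value_atM.
  by rewrite mulf_neq0.
by rewrite expfzDr ?(local_parameter_neq0 clK hdim ht) // mulrACA.
Qed.

Lemma bounded_exact A phi : rr (A + PD) phi -> ~ rr A phi ->
  order_at P phi (- (coeff P A + 1)).
Proof.
move=> hphi nphi; have nz : phi != 0.
  by apply/eqP => p0; apply: nphi; rewrite p0; apply: (rr_subspace A).1.
have [n on] := order_at_exists clK hdim hparam P (rational_geometric hphi.1) nz.
have bE k := order_at_bounded clK hdim hparam k on.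
suff -> : - (coeff P A + 1) = n by [].
have : 0 <= n + (coeff P A + 1).
  by apply/bE; have := hphi.2 P; rewrite coeffD coeff_point eqxx.
have : ~~ (0 <= n + coeff P A).
  by apply/negP => /bE b; apply: nphi; apply: rr_succP.
by move: (coeff P A) => k; lia.
Qed.

(** If one more pole at [P] does not enlarge [rr A], then at most one of the
    two filtrations [rr (A - j P)] and [rr (j P)] jumps at each step [j]: a
    product of two functions responsible for the jumps would have exact order
    [- (A(P) + 1)] at [P]. *)
Lemma rr_no_double_jump A B phi psi :
  (forall chi, rr (A + PD) chi -> rr A chi) ->
  rr (A - B) phi -> ~ rr (A - B - PD) phi ->
  rr (B + PD) psi -> ~ rr B psi -> False.
Proof.
move=> noA hphi nphi hpsi npsi.
have := bounded_exact (A := A - B - PD) _ nphi; rewrite subrK => /(_ hphi) ophi.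
have opsi := bounded_exact hpsi npsi.
have /noA[_ /(_ P)] : rr (A + PD) (phi * psi).
  have -> : A + PD = (A - B) + (B + PD) by rewrite addrA subrK.
  exact: rrM.
move/(order_at_bounded clK hdim hparam _ (order_atM ophi opsi)).
rewrite !(coeffD, coeffN, coeff_point) eqxx.
by move: (coeff P A) (coeff P B) => x y; lia.
Qed.

End RationalPoint.

End RiemannRoch.

(** * Consequences of Riemann's inequality *)

Section Genus.
Variables (F : fieldType) (K : closedFieldType) (iota : {rmorphism F -> K}).
Variable X : variety iota.
Local Notation N := (ambient X).
Local Notation IX := (@ideal _ _ _ X).
Variables (E : fieldType) (cl : {rmorphism {mpoly K[N.+1]} -> E}).
Hypothesis clK : forall a, (cl a == 0) = (a \in IX).
Local Notation const := (cl \o @mpolyC N.+1 K).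
Local Notation rational := (rational cl).
Local Notation value_at := (value_at cl).
Local Notation bounded := (bounded cl).
Local Notation rr := (rr cl).
Local Notation F_dim := (F_dim (const \o iota)).
Hypothesis hdim : dimension_is cl 1.
Hypothesis hparam : forall P, exists t, local_parameter cl P t.
Hypothesis hrat : forall P phi c, rational_point P -> rational phi ->
  value_at P phi c -> exists d, c = iota d.
Variable g : nat.
Hypothesis hg : genus_is cl g.
Implicit Types (P : point X) (A B : divisor X) (phi psi : E).

Lemma riemann_inequality A n : rational_divisor A -> F_dim (rr A) n ->
  deg A - n%:Z + 1 <= g%:Z.
Proof.
move=> rA dA; apply: hg.2 => //; apply: F_dim_ext dA => x.
by split => /(rr_spaceE clK hdim hparam A x).
Qed.

Section RationalPoint.
Variable P : point X.
Hypothesis ratP : rational_point P.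
Local Notation PD := (<< P >> : divisor X).

Let rPD := rational_divisor_point ratP.
Let sub A := rr_subspace clK hdim hparam A.
Let succ_dim := rr_succ_dim clK hdim hparam hrat ratP.

Lemma deg_point : deg PD = 1.
Proof. exact: degU. Qed.

(** The divisor of finite dimension that attains the genus acquires, by adding
    multiples of [P], a nonzero section; multiplication by it embeds [rr 0]. *)
Lemma rr0_finite : exists n, F_dim (rr 0) n.
Proof.
have [[A [n [rA dA _]]] _] := hg.
have {}dA : F_dim (rr A) n.
  by apply: F_dim_ext dA => x; apply: rr_spaceE clK hdim hparam A x.
pose j := (`|deg A| + g)%N; have [n' d'] := rr_add_dim clK hdim hparam hrat ratP j dA.
have := riemann_inequality (rational_divisorD rA (rational_divisorMn j rPD)) d'.
rewrite degD degMn deg_point /j => le_g; case: n' d' le_g => [|n'] d' le_g.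
  by exfalso; move: le_g; move: (deg A) => x; lia.
have [b [Vb fb _]] := d'; pose chi := b 0.
have nchi : chi != 0.
  apply/eqP => c0; have h : \sum_i (const \o iota) (i == 0)%:R * b i = 0.
    rewrite big1 // => i _; have [->|_] := eqVneq i 0; first by rewrite -/chi c0 mulr0.
    by rewrite rmorph0 mul0r.
  by have /eqP := fb _ h 0; rewrite eqxx oner_eq0.
have [|k _ dk] := F_dim_mul (sub 0) d' nchi; last by exists k.
by move=> x h0; rewrite -[A + _]addr0; apply: (rrM clK hdim hparam) h0; apply: Vb.
Qed.

(** Multiplication by powers of a function embeds [rr (- n B)] in [rr 0], while
    the dimension of the former grows with [n] when [deg B < 0]. *)
Lemma rr_neg_deg B phi : rational_divisor B -> deg B < 0 -> rr B phi -> phi = 0.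
Proof.
move=> rB dB hphi; apply/eqP/contraT => nphi; have [k dk] := rr0_finite.
pose n := (g + k)%N.
have [|j jk dj] := F_dim_mul (sub (- (B *+ n))) dk (expf_neq0 n nphi).
  move=> x hx; have -> : (0 : divisor X) = B *+ n + - (B *+ n) by rewrite subrr.
  exact: (rrM clK hdim hparam) (rrX clK hdim hparam n hphi) hx.
have := riemann_inequality (rational_divisorN (rational_divisorMn n rB)) dj.
rewrite degN degMn -mulr_natr /n; move: (deg B) dB jk => x.
by nia.
Qed.

(** Subtract points until the degree is negative, then add them back: each one
    raises the dimension by at most one. *)
Lemma rr_finite A : rational_divisor A -> exists n, F_dim (rr A) n.
Proof.
move: {2}(`|deg A|.+1) (leqnn `|deg A|.+1) => k.
have : deg A < (`|deg A|.+1)%:Z by move: (deg A) => x; lia.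
move: (`|deg A|.+1) => {}k lt_k _; elim: k A lt_k => [|k IH] A lt_k rA.
  exists 0%N; apply: F_dim_zero (sub A).1 _ => x; exact: rr_neg_deg.
have [||n dn] := IH (A - PD); first by rewrite degB deg_point; lia.
  exact: (rational_divisorD rA (rational_divisorN rPD)).
have := succ_dim dn; rewrite subrK => -[[d _]|[d _]]; [by exists n | by exists n.+1].
Qed.

(** A function without poles minus its value at [P] has a zero and no pole, hence
    vanishes. *)
Lemma rr0_dim1 : F_dim (rr 0) 1.
Proof.
exists (fun=> 1); split=> [_||phi hphi].
- exact: rr1 clK hdim hparam.
- move=> c; rewrite big_ord1 mulr1 => /eqP; rewrite fmorph_eq0 => /eqP c0 i.
  by rewrite (ord1 i).
- have [c hc] : exists c, value_at P phi c.
    by apply/(bounded0E clK hdim hparam); have := hphi.2 P; rewrite coeff0.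
  have [d cd] := hrat ratP hphi.1 hc; exists (fun=> d); rewrite big_ord1 mulr1.
  apply/eqP; rewrite -subr_eq0; apply/eqP; apply: (@rr_neg_deg (- PD)).
  - exact: (rational_divisorN rPD).
  - by rewrite degN deg_point.
  have h0 : rr 0 (phi - (const \o iota) d).
    have -> : phi - (const \o iota) d = (const \o iota) (- d) * 1 + phi.
      by rewrite mulr1 rmorphN addrC.
    exact: (sub 0).2 (rr1 clK hdim hparam) hphi.
  apply: (rr_succP (P := P)); first by rewrite addNr.
  rewrite coeffN coeff_point eqxx; apply/(boundedN1E clK hdim hparam).
  have := value_atB clK hc (value_at_const cl P c); rewrite subrr.
  by rewrite [in const c]cd.
Qed.

(** The half of the Riemann-Roch theorem that is needed, obtained without
    duality by counting the jumps of two filtrations, that of [rr A] by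
    [rr (A - j P)] and that of the union of the [rr (j P)]. *)
Lemma rr_no_jump_deg A : rational_divisor A ->
  (forall phi, rr (A + PD) phi -> rr A phi) -> deg A <= (2 * g)%:Z - 2.
Proof.
move=> rA noA; have [a0 da0] := rr_finite rA.
have count j a z : F_dim (rr (A - PD *+ j)) a -> F_dim (rr (PD *+ j)) z ->
    (a0 + z <= a + j.+1)%N.
  elim: j a z => [|j IH] a z.
    rewrite mulr0n subr0 => /(F_dim_unique da0)-> /(F_dim_unique rr0_dim1)<-.
    by [].
  have [b db] : exists b, F_dim (rr (PD *+ j)) b.
    exact: (rr_finite (rational_divisorMn j rPD)).
  have eA : A - PD *+ j = A - PD *+ j.+1 + PD by rewrite mulrSr opprD addrA subrK.
  have eA' : A - PD *+ j.+1 = A - PD *+ j - PD by rewrite mulrSr opprD addrA.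
  move=> da; have [a' da'] : exists a', F_dim (rr (A - PD *+ j)) a'.
    exact: (rr_finite (rational_divisorD rA (rational_divisorN (rational_divisorMn j rPD)))).
  rewrite mulrSr => dz; have := IH _ _ da' db.
  have := succ_dim da; have := succ_dim db; rewrite -eA.
  case=> [[/(F_dim_unique dz)-> _]|[/(F_dim_unique dz)-> [psi hpsi npsi]]];
  case=> [[/(F_dim_unique da')-> _]|[/(F_dim_unique da')-> [phi hphi nphi]]]; try lia.
  exfalso; rewrite eA' in nphi.
  exact: (rr_no_double_jump clK hdim hparam noA hphi nphi hpsi npsi).
pose n := `|deg A|.+1.
have rn : rational_divisor (A - PD *+ n).
  exact: (rational_divisorD rA (rational_divisorN (rational_divisorMn n rPD))).
have d0 : F_dim (rr (A - PD *+ n)) 0.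
  apply: F_dim_zero (sub _).1 _ => x; apply: (rr_neg_deg rn).
  by rewrite degB degMn deg_point /n; move: (deg A) => y; lia.
have [z dz] := rr_finite (rational_divisorMn n rPD).
have := riemann_inequality (rational_divisorMn n rPD) dz.
have := count _ _ _ d0 dz.
have : F_dim (rr (A + PD)) a0.
  by have := succ_dim da0 => -[[//]|[_ [phi /noA]]].
move/(riemann_inequality (rational_divisorD rA rPD)).
rewrite degD degMn deg_point; move: (deg A) => x; lia.
Qed.

Lemma rr_jump A : rational_divisor A -> (2 * g)%:Z - 1 <= deg A ->
  exists2 phi, rr (A + PD) phi & ~ rr A phi.
Proof.
move=> rA dA; apply: contrapT => h.
have : deg A <= (2 * g)%:Z - 2.
  apply: rr_no_jump_deg => // phi hphi; apply: contrapT => nphi.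
  by apply: h; exists phi.
by move: dA; move: (deg A) => x; lia.
Qed.

End RationalPoint.

Section EvaluationCode.
Variables (m : nat) (P : 'I_m -> point X) (D : divisor X).
Hypothesis Pinj : injective P.
Hypothesis Prat : forall i, rational_point (P i).
Hypothesis Drat : rational_divisor D.
Hypothesis disj : forall i, coeff (P i) D = 0.

Definition evaluation_code (x : 'rV[F]_m) : Prop :=
  exists2 phi, rr_space cl D phi & forall i, value_at (P i) phi (iota (x 0 i)).

Let points (S : {set 'I_m}) : divisor X := \sum_(i in S) << P i >>.

Fact deg_points S : deg (points S) = #|S|%:Z.
Proof.
rewrite /points raddf_sum /= (eq_bigr (fun=> 1)); last by move=> i _; exact: degU.
by rewrite sumr_const natz.
Qed.

Fact coeff_points S i : coeff (P i) (points S) = (i \in S)%:R.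
Proof.
rewrite /points raddf_sum /= (eq_bigr (fun j => if j == i then 1 else 0)); last first.
  by move=> j _; rewrite coeffU mul1r (inj_eq Pinj); case: eqP.
rewrite -big_mkcondr /=; case: (boolP (i \in S)) => iS; last first.
  by rewrite big1 // => j /andP[jS /eqP ji]; rewrite -ji jS in iS.
by rewrite (eq_bigl (pred1 i)) ?big_pred1_eq // => j /=; case: eqP => [->|]; rewrite ?andbT ?andbF.
Qed.

Fact coeff_points_out S Q : (forall i, Q != P i) -> coeff Q (points S) = 0.
Proof.
move=> nQ; rewrite /points raddf_sum /= big1 // => i _.
by rewrite coeffU mul1r eq_sym (negbTE (nQ i)).
Qed.

Fact rational_points S : rational_divisor (points S).
Proof.
rewrite /points; elim/big_rec: _ => [|i A _]; first exact: rational_divisor0.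
by move=> rA; exact: (rational_divisorD (rational_divisor_point (Prat i)) rA).
Qed.

Lemma evaluation_exists phi : rr D phi ->
  exists2 x, evaluation_code x & forall i, value_at (P i) phi (iota (x 0 i)).
Proof.
move=> hphi; have /choice[x hx] : forall i, exists d, value_at (P i) phi (iota d).
  move=> i; have [c hc] : exists c, value_at (P i) phi c.
    by apply/(bounded0E clK hdim hparam); rewrite -(disj i); apply: hphi.2.
  by have [d cd] := hrat (Prat i) hphi.1 hc; exists d; rewrite -cd.
exists (\row_i x i); last by move=> i; rewrite mxE.
exists phi => [|i]; last by rewrite mxE.
exact/(rr_spaceE clK hdim hparam).
Qed.

Lemma evaluation_codeZ c x : evaluation_code x -> evaluation_code (c *: x).
Proof.
move=> [phi /(rr_spaceE clK hdim hparam) hphi vphi].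
exists ((const \o iota) c * phi) => [|i].
  apply/(rr_spaceE clK hdim hparam); rewrite -[_ * _]addr0.
  by have [z h] := rr_subspace clK hdim hparam D; apply: h.
by rewrite mxE rmorphM; apply: value_atM; first exact: value_at_const.
Qed.

(** A function of the space vanishing at the points indexed by [Z] belongs to
    the space of [D - sum_Z P_i], whose degree is therefore nonnegative. *)
Lemma evaluation_code_weight x : evaluation_code x -> x != 0 ->
  m%:Z - deg D <= #|[set i | x 0 i != 0]|%:Z.
Proof.
move=> [phi /(rr_spaceE clK hdim hparam) hphi vphi] nx.
pose Z := [set i | x 0 i == 0].
have /rV0Pn[i0 nxi0] := nx.
have nphi : phi != 0 by apply: (value_at_neq0 clK (vphi i0)); rewrite fmorph_eq0.
have hZ : rr (D - points Z) phi.
  split=> [|Q]; first exact: hphi.1.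
  rewrite coeffB; case: (pselect (exists i, Q = P i)) => [[i ->]|nQ]; last first.
    rewrite coeff_points_out ?subr0; first exact: hphi.2.
    by move=> i; apply/eqP => Qi; apply: nQ; exists i.
  rewrite coeff_points inE; have [xi|_] := eqVneq (x 0 i) 0; last first.
    by rewrite subr0; apply: hphi.2.
  rewrite disj sub0r; apply/(boundedN1E clK hdim hparam).
  by have := vphi i; rewrite xi rmorph0.
have : 0 <= deg (D - points Z).
  rewrite leNgt; apply: contra nphi => neg; apply/eqP; apply: (rr_neg_deg (Prat i0)) neg hZ.
  exact: (rational_divisorD Drat (rational_divisorN (rational_points Z))).
rewrite degB deg_points; have := cardsC Z; rewrite card_ord.
have -> : ~: Z = [set i | x 0 i != 0] by apply/setP => i; rewrite !inE.
by move: #|Z| #|[set i | x 0 i != 0]| (deg D) => a b y; lia.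
Qed.

Lemma evaluation_code_separates (S : {set 'I_m}) i c : i \in S ->
  #|S|%:Z <= deg D - (2 * g)%:Z + 1 ->
  exists x, [/\ evaluation_code x, x 0 i = c & forall j, j \in S -> j != i -> x 0 j = 0].
Proof.
move=> iS cardS; pose B := D - points S.
have rB : rational_divisor B.
  exact: (rational_divisorD Drat (rational_divisorN (rational_points S))).
have [|phi hphi nphi] := rr_jump (Prat i) rB.
  by rewrite /B degB deg_points; move: cardS; move: (deg D) => y; lia.
have cB j : coeff (P j) B = - (j \in S)%:R by rewrite coeffB disj sub0r coeff_points.
have hD : rr D phi.
  apply: (rr_sub clK hdim hparam) hphi => Q; rewrite coeffD coeff_point.
  have [<-|nQ] := eqVneq (P i) Q; first by rewrite cB iS disj.
  rewrite addr0 coeffB lerBlDr lerDl.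
  case: (pselect (exists j, Q = P j)) => [[j ->]|nj]; first by rewrite coeff_points ler0n.
  by rewrite coeff_points_out // => j; apply/eqP => Qj; apply: nj; exists j.
have [x cx vx] := evaluation_exists hD.
have nxi : x 0 i != 0.
  apply/eqP => xi; apply: nphi; apply: (rr_succP hphi); rewrite cB iS.
  by apply/(boundedN1E clK hdim hparam); have := vx i; rewrite xi rmorph0.
exists ((c / x 0 i) *: x); split; first exact: evaluation_codeZ.
  by rewrite mxE divfK.
move=> j jS ji; rewrite mxE; suff -> : x 0 j = 0 by rewrite mulr0.
have bj : bounded (P j) phi (-1).
  have := hphi.2 (P j); rewrite coeffD cB jS coeff_point (inj_eq Pinj).
  by rewrite eq_sym (negbTE ji) addr0.
have /(boundedN1E clK hdim hparam) := bj => /(value_at_unique clK (vx j)) /eqP.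
by rewrite fmorph_eq0 => /eqP.
Qed.

End EvaluationCode.
End Genus.

(** * Taylor coefficients of quotients of polynomials *)

Section TaylorQuotient.
Variable R : realType.
Implicit Types (p q d : {poly R}) (h : R -> R).

Lemma horner_neq0_near d (t : R) : d.[t] != 0 -> \forall s \near t, d.[s] != 0.
Proof.
by move=> dt; exact: (cvgr_neq0 d.[t] (@continuous_horner R d t) dt).
Qed.

Lemma derive1_quotient p q d (t : R) : d.[t] != 0 ->
  derive1 (fun s => p.[s] + q.[s] / d.[s]) t =
    (p^`()).[t] + (q^`() * d - q * d^`()).[t] / (d ^+ 2).[t].
Proof.
move=> dt; have dd := is_derive_poly d t.
have dV : is_derive t 1 (fun s => (d.[s])^-1) (- d.[t] ^- 2 *: d^`().[t]).
  by apply: DeriveDef; [exact: derivableV | rewrite deriveV // derive_val].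
have dpq := is_deriveD (is_derive_poly p t) (is_deriveM (is_derive_poly q t) dV).
rewrite derive1E; transitivity (p^`().[t] +
    (q.[t] *: (- d.[t] ^- 2 *: d^`().[t]) + d.[t]^-1 *: q^`().[t])).
  exact: (@derive_val _ _ _ _ _ _ _ dpq).
rewrite hornerD hornerN !hornerM /GRing.scale /=; congr (_ + _).
by field.
Qed.

(** Differentiation turns a perturbation of the form [X^(a+1) q / d] into one of
    the form [X^a q' / d^2], whence an induction on the order. *)
Lemma derive1n_quotient h p q d a : d.[0] != 0 ->
  (\forall t \near 0, h t = p.[t] + ('X^a * q).[t] / d.[t]) ->
  forall j, (j < a)%N -> derive1n j h 0 = (p^`(j)).[0].
Proof.
elim: a h p q d => // a IH h p q d d0 hE [|j] ja.
  rewrite derive1n0 derivn0 (nbhs_singleton hE).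
  by rewrite hornerM hornerXn expr0n mul0r mul0r addr0.
rewrite derive1Sn derivSn.
apply: (IH _ _ (q *+ a.+1 * d + 'X * (q^`() * d - q * d^`())) (d ^+ 2)) => //.
  by rewrite horner_exp expf_neq0.
have hE2 := near_join hE; near=> t.
have dt : d.[t] != 0 by near: t; apply: horner_neq0_near.
have -> : derive1 h t = derive1 (fun s => p.[s] + ('X^(a.+1) * q).[s] / d.[s]) t.
  by rewrite !derive1E; apply: near_eq_derive; near: t; exact: hE2.
rewrite derive1_quotient //; congr (_ + _.[_] / _).
rewrite derivM derivXn /= exprS; ring.
Unshelve. all: by end_near. Qed.
End TaylorQuotient.

(** * Expansion of the rational map of a binary code *)

Section CodeExpansion.
Variables (R : realType) (n : nat) (C : {set 'rV['F_2]_n}).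
Hypothesis C0 : 0 \in C.
Hypothesis CD : forall x y, x \in C -> y \in C -> x + y \in C.
Implicit Types (x y z : 'rV['F_2]_n) (T : {set 'I_n}) (u v : 'rV[R]_n).

Definition F2_sign (a : 'F_2) : R := if a == 1 then -1 else 1.

Lemma F2_signD a b : F2_sign (a + b) = F2_sign a * F2_sign b.
Proof.
rewrite /F2_sign; case: a => -[|[|//]] ?; case: b => -[|[|//]] ?;
  by rewrite -!val_eqE /= ?mulr1 ?mul1r ?mulrNN ?mulr1.
Qed.

Lemma F2_sign_sum T x : F2_sign (\sum_(j in T) x 0 j) = \prod_(j in T) F2_sign (x 0 j).
Proof. by apply: (big_morph F2_sign F2_signD); rewrite /F2_sign. Qed.

(** Translation by [z] multiplies the sum by the value of the character at [z],
    which is [-1]. *)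
Lemma character_sum_eq0 T : (exists2 z, z \in C & \sum_(j in T) z 0 j != 0) ->
  \sum_(x in C) \prod_(j in T) F2_sign (x 0 j) = 0.
Proof.
case=> z zC nz; set S := \sum_(x in C) _.
have zz : z + z = 0.
  by apply/rowP => j; rewrite !mxE; apply/eqP; case: (z 0 j) => -[|[|//]] ?.
have sz : F2_sign (\sum_(j in T) z 0 j) = -1.
  by move: nz; case: (\sum_(j in T) _) => -[|[|//]] ?; rewrite /F2_sign -!val_eqE.
have SN : S = - S.
  rewrite {1}/S (reindex_inj (addIr z)) -mulN1r -sz mulr_sumr.
  apply: eq_big => [x|x _]; last first.
    rewrite -!F2_sign_sum -F2_signD addrC; congr F2_sign.
    by rewrite -big_split /=; apply: eq_bigr => j _; rewrite mxE addrC.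
  apply/idP/idP => [xzC|]; last by move/CD; apply.
  by rewrite -[x]addr0 -zz addrA; apply: CD.
by apply/eqP; rewrite -[_ == _](mulrn_eq0 S 2) mulr2n {2}SN subrr.
Qed.

Section Line.
Variable v : 'rV[R]_n.

(** The factor of coordinate [j] at [center + t v], as a polynomial in [t]: the
    bit enters only through its sign. *)
Definition line_factor x j : {poly R} := (2^-1)%:P - F2_sign (x 0 j) *: (v 0 j *: 'X).

Definition line_word x : {poly R} := \prod_j line_factor x j.

Lemma word_factor_line x t : word_factor x (center R n + t *: v) = (line_word x).[t].
Proof.
rewrite /word_factor /line_word horner_prod; apply: eq_bigr => j _.
rewrite !mxE /line_factor hornerD hornerN !hornerZ hornerX hornerC /F2_sign.
by case: ifP => _; field.
Qed.

Definition line_den : {poly R} := \sum_(x in C) line_word x.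
Definition line_num i : {poly R} := \sum_(x in C | x 0 i == 1) line_word x.

Lemma rational_map_line i t :
  rational_map C (center R n + t *: v) 0 i = (line_num i).[t] / (line_den).[t].
Proof.
by rewrite mxE !horner_sum; congr (_ / _); apply: eq_bigr => x _; rewrite word_factor_line.
Qed.

Lemma line_den0 : (line_den).[0] != 0.
Proof.
rewrite horner_sum (eq_bigr (fun=> 2^-1 ^+ n)); last first.
  move=> x _; rewrite horner_prod (eq_bigr (fun=> 2^-1)) ?prodr_const ?card_ord // => j _.
  by rewrite /line_factor hornerD hornerN !hornerZ hornerX hornerC !mulr0 subr0.
rewrite sumr_const mulrn_eq0 negb_or (expf_neq0 n) ?invr_eq0 ?pnatr_eq0 // andbT.
by rewrite -lt0n; apply/card_gt0P; exists 0.
Qed.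

Definition coord_line i : {poly R} := (2^-1)%:P + v 0 i *: 'X.

(** Expanding the products over all coordinates, each monomial of degree [k] in
    the numerator of [f_i - u_i] carries the sum over the code of a character
    supported by at most [k + 1] coordinates; these sums vanish below the dual
    distance. *)
Lemma line_num_dvd l i :
  (forall T, (0 < #|T| <= l)%N -> exists2 z, z \in C & \sum_(j in T) z 0 j != 0) ->
  'X^l %| line_num i - coord_line i * line_den.
Proof.
move=> strength.
pose c j : {poly R} := if j == i then - ((4^-1)%:P - (v 0 i *: 'X) ^+ 2) else - (v 0 j *: 'X).
pose a j : {poly R} := if j == i then 0 else (2^-1)%:P.
have -> : line_num i - coord_line i * line_den =
    \sum_(x in C) \prod_j (a j + F2_sign (x 0 j) *: c j).
  rewrite /line_num big_mkcondr /line_den mulr_sumr -sumrB /=.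
  apply: eq_bigr => x _; rewrite /line_word (bigD1 i) //= [RHS](bigD1 i) //=.
  set p := \prod_(j | j != i) line_factor x j.
  have -> : \prod_(j | j != i) (a j + F2_sign (x 0 j) *: c j) = p.
    apply: eq_bigr => j /negbTE nji.
    by rewrite /a /c nji scalerN /line_factor.
  rewrite /a /c eqxx add0r /line_factor /coord_line.
  have h2 : (2^-1 : R)%:P * (2^-1)%:P = (4^-1)%:P by rewrite -polyCM; congr polyC; field.
  have h1 : (2^-1 : R)%:P + (2^-1)%:P = 1 by rewrite -polyCD -polyC1; congr polyC; field.
  set w := v 0 i *: 'X; set h := (2^-1)%:P in h1 h2 *.
  case: eqP => [->|/eqP x1].
    rewrite /F2_sign eqxx !scaleN1r -h2; apply/eqP; rewrite -subr_eq0; apply/eqP.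
    by transitivity ((1 - (h + h)) * ((h + w) * p)); [ring | rewrite h1 subrr mul0r].
  have -> : F2_sign (x 0 i) = 1 by rewrite /F2_sign ifN.
  rewrite !scale1r -h2; ring.
under eq_bigr => x _ do rewrite bigA_distr.
rewrite exchange_big /=; elim/big_ind: _ => [|p q|J _]; [exact: dvdp0 | exact: dvdp_add |].
have -> : \sum_(x in C) \prod_j (if j \in J then a j else F2_sign (x 0 j) *: c j) =
    (\prod_(j in J) a j * \prod_(j in ~: J) c j) *
    (\sum_(x in C) \prod_(j in ~: J) F2_sign (x 0 j))%:P.
  rewrite rmorph_sum mulr_sumr; apply: eq_bigr => x _.
  rewrite (bigID (mem J)) /= -mulrA; congr (_ * _); first by apply: eq_bigr => j ->.
  rewrite rmorph_prod -big_split /=.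
  rewrite (eq_bigl (fun j => j \in ~: J)) => [|j]; last by rewrite inE.
  by apply: eq_bigr => j; rewrite inE => /negbTE->; rewrite -mul_polyC mulrC.
have [iJ|niJ] := boolP (i \in J).
  by rewrite (bigD1 i) //= {1}/a eqxx !mul0r dvdp0.
have iT : i \in ~: J by rewrite inE.
have [small|large] := leqP #|~: J| l.
  rewrite character_sum_eq0 ?mulr0 ?dvdp0 //.
  by apply: strength; rewrite small andbT; apply/card_gt0P; exists i.
apply/dvdp_mulr/dvdp_mull; rewrite (bigD1 i) //=; apply: dvdp_mull.
apply: (@dvdp_trans _ ('X^(#|~: J :\ i|))).
  by apply: dvdp_exp2l; move: large; rewrite (cardsD1 i) iT.
rewrite -prodr_const (eq_bigl (fun j => (j \in ~: J) && (j != i))); last first.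
  by move=> j; rewrite !inE andbC.
elim/big_rec2: _ => [|j p q /andP[_ /negbTE nji] pq]; first exact: dvdpp.
by apply: dvdp_mul => //; rewrite /c nji dvdpNr -mul_polyC dvdp_mull.
Qed.

End Line.

(** The factors of a word as functions, so that the product rule applies. *)
Definition coord_word x j : 'rV[R]_n -> R :=
  if x 0 j == 1 then fun u => u 0 j else (fun=> 1) - fun u => u 0 j.

Lemma differentiable_word_factor x u : differentiable (@word_factor R n x) u.
Proof.
have -> : @word_factor R n x = \prod_j coord_word x j.
  apply/funext => w; rewrite /word_factor fct_prodE; apply: eq_bigr => j _.
  by rewrite /coord_word; case: ifP.
elim/big_ind: _ => [|f h df dh|j _]; first exact: differentiable_cst.
  exact: differentiableM.
rewrite /coord_word; case: ifP => _; first exact: differentiable_coord.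
by apply: differentiableB; [exact: differentiable_cst | exact: differentiable_coord].
Qed.

Lemma differentiable_word_sum (D : pred 'rV['F_2]_n) u :
  differentiable (fun w => \sum_(x in C | D x) word_factor x w) u.
Proof.
rewrite (_ : (fun w => _) = \sum_(x in C | D x) @word_factor R n x); last first.
  by apply/funext => w; rewrite fct_sumE.
elim/big_ind: _ => [|f h df dh|x _]; first exact: differentiable_cst.
  exact: differentiableD.
exact: differentiable_word_factor.
Qed.

Lemma differentiable_rational_map : differentiable (@rational_map R n C) (center R n).
Proof.
have den0 : \sum_(x in C) word_factor x (center R n) != 0.
  have := line_den0 0; rewrite /line_den horner_sum.
  under eq_bigr => x _ do rewrite -word_factor_line scaler0 addr0.
  by [].
have -> : @rational_map R n C =
    \sum_i (fun u => rational_map C u 0 i *: (delta_mx 0 i : 'rV[R]_n)).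
  by apply/funext => u; rewrite fct_sumE -row_sum_delta.
apply: differentiable_sum => i; apply: differentiableZl.
rewrite (_ : (fun u => _) = (fun u => \sum_(x in C | x 0 i == 1) word_factor x u) *
    (fun u => (\sum_(x in C) word_factor x u)^-1)); last first.
  by apply/funext => u; rewrite mxE.
apply: differentiableM; first exact: differentiable_word_sum.
apply: differentiableV den0.
rewrite (_ : (fun u => _) = (fun u => \sum_(x in C | true) word_factor x u)).
  exact: differentiable_word_sum.
by apply/funext => u; apply: eq_bigl => x; rewrite andbT.
Qed.

Definition line_coord v i (t : R) : R := rational_map C (center R n + t *: v) 0 i.

Lemma jacobian_line v i :
  (v *m jacobian (@rational_map R n C) (center R n)) 0 i = (derive1n 1 (line_coord v i)) 0.
Proof.
have df := differentiable_rational_map.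
rewrite -deriveEjacobian // derive_mx; last exact: diff_derivable.
rewrite mxE derive1n1 /derive /derive1.
set f1 := (f1 in lim (nbhs (fmap f1 _)) = _); set f2 := (f2 in _ = lim (nbhs (fmap f2 _))).
suff -> : f1 = f2 by [].
apply/funext => h; rewrite /f1 /f2 /line_coord /= scale0r !addr0.
by rewrite [center R n + _]addrC.
Qed.

Section Truncation.
Variable l : nat.
Hypothesis strength : forall T, (0 < #|T| <= l)%N ->
  exists2 z, z \in C & \sum_(j in T) z 0 j != 0.

Lemma derive1n_line_coord v i j : (j < l)%N ->
  derive1n j (line_coord v i) 0 = ((coord_line v i)^`(j)).[0].
Proof.
have /dvdpP[q qE] := line_num_dvd v i strength.
apply: (derive1n_quotient (q := q) (line_den0 v)).
near=> t.
have dt : (line_den v).[t] != 0 by near: t; apply: horner_neq0_near; exact: line_den0.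
rewrite /line_coord rational_map_line ['X^l * q]mulrC -qE hornerD hornerN hornerM.
by field.
Unshelve. all: by end_near. Qed.

Lemma truncated_mapE u i : (2 <= l)%N ->
  truncated_map C l u 0 i = u 0 i + taylor_term C l (u - center R n) 0 i.
Proof.
move=> l2; rewrite /truncated_map; set v := u - center R n.
rewrite big_nat_recr //= mxE [X in X + _]mxE [X in _ + X]mxE.
have -> : (v *m jacobian (rational_map C) (center R n)) 0 i = v 0 i.
  rewrite jacobian_line derive1n_line_coord // /coord_line derivn1.
  by rewrite derivD derivC add0r derivZ derivX hornerZ hornerC mulr1.
have -> : (\sum_(2 <= j < l) taylor_term C j v) 0 i = 0.
  rewrite summxE big_nat_cond big1 // => j /andP[/andP[j2 jl] _].
  rewrite mxE -[X in derive1n j X]/(line_coord v i) derive1n_line_coord //.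
  rewrite derivn_poly0 ?horner0 ?mulr0 // (leq_trans _ j2) // /coord_line.
  rewrite (leq_trans (size_polyD _ _)) // geq_max (leq_trans (size_polyC_leq1 _)) //=.
  by rewrite (leq_trans (size_scale_leq _ _)) // size_polyX.
rewrite add0r; congr (_ + _).
by rewrite /v !mxE addrC subrK.
Qed.

End Truncation.
End CodeExpansion.

(** * Expanded geometric Reed-Solomon codes *)

(** Read off a matrix with a single nonzero entry. *)
Lemma mxvec_index_inj m n (i i' : 'I_m) (j j' : 'I_n) :
  mxvec_index i j = mxvec_index i' j' -> i = i' /\ j = j'.
Proof.
move=> eq_ij; have := mxvecE (delta_mx i j : 'M[rat]_(m, n)) i j.
rewrite {1}eq_ij mxvecE !mxE !eqxx /=.
by case: eqP => [->|_]; case: eqP => [->|_].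
Qed.

Section ExpandedCodes.
Variables (s : nat) (F : fieldExtType 'F_2) (e : s.-tuple F).
Hypothesis he : basis_of fullv e.
Variable m : nat.
Implicit Types (x : 'rV[F]_m).

Lemma expandE x i j : expand e x 0 (mxvec_index i j) = coord e j (x 0 i).
Proof. by rewrite /expand mxvecE mxE. Qed.

Lemma expand0 : expand e (0 : 'rV[F]_m) = 0.
Proof. by apply/rowP => k; case/mxvec_indexP: k => i j; rewrite expandE !mxE linear0. Qed.

Lemma basis_length_gt0 : (0 < s)%N.
Proof. by rewrite -(vector.size_basis he); exact: (adim_gt0 {:F}). Qed.

Lemma coord_neq0 (a : F) : a != 0 -> exists j, coord e j a != 0.
Proof.
move=> na; apply: contrapT => nj; case/eqP: na.
have ae : a \in <<e>>%VS by rewrite (span_basis he) memvf.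
rewrite (coord_span ae) big1 // => j _.
by have [->|nz] := eqVneq (coord e j a) 0; [rewrite scale0r | case: nj; exists j].
Qed.

Lemma weight_expand x : (#|[set i | (x 0 i != 0)%R]| <= weight (expand e x))%N.
Proof.
pose j0 : 'I_s := Ordinal basis_length_gt0.
have /choice[J hJ] : forall i : 'I_m, exists j, x 0 i != 0 -> coord e j (x 0 i) != 0.
  move=> i; have [_|/coord_neq0[j hj]] := eqVneq (x 0 i) 0; [by exists j0 | by exists j].
rewrite -(card_imset (f := fun i => mxvec_index i (J i))) => [|i i' /mxvec_index_inj[]//].
by apply/subset_leq_card/subsetP => k /imsetP[i]; rewrite !inE => nxi ->; rewrite expandE hJ.
Qed.

End ExpandedCodes.

Section ConeField.
Variables (F : fieldType) (K : closedFieldType) (iota : {rmorphism F -> K}).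
Variable X : variety iota.
Local Notation N := (ambient X).
Local Notation IX := (@ideal _ _ _ X).

Definition cone_fun (a : {mpoly K[N.+1]}) : cone_field X := tofrac (coord_class a).

Fact cone_fun_is_zmod_morphism : zmod_morphism cone_fun.
Proof.
move=> a b; rewrite /cone_fun /coord_class -tofracB; congr tofrac.
exact: (raddfB (\pi_{ideal_quot IX})%qT).
Qed.

Fact cone_fun_is_monoid_morphism : monoid_morphism cone_fun.
Proof.
split=> [|a b]; rewrite /cone_fun /coord_class.
  by rewrite (rmorph1 (\pi_{ideal_quot IX})%qT) tofrac1.
by rewrite (rmorphM (\pi_{ideal_quot IX})%qT) tofracM.
Qed.

HB.instance Definition _ := GRing.isZmodMorphism.Build _ _ cone_fun
  cone_fun_is_zmod_morphism.
HB.instance Definition _ := GRing.isMonoidMorphism.Build _ _ cone_fun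
  cone_fun_is_monoid_morphism.

Definition cone_rmorph : {rmorphism {mpoly K[N.+1]} -> cone_field X} := cone_fun.

Lemma cone_rmorph_eq0 a : (cone_rmorph a == 0) = (a \in IX).
Proof.
rewrite /cone_rmorph /= /cone_fun tofrac_eq0 /coord_class -(subr0 a) Quotient.idealrBE subr0.
by rewrite (rmorph0 (\pi_{ideal_quot IX})%qT).
Qed.

(** Over the cone field, the notions attached to an abstract field [E] are
    convertible to the original ones. *)
Lemma dimension_cone : has_dimension X 1 -> dimension_is cone_rmorph 1.
Proof. exact. Qed.

Lemma genus_cone g : has_genus X g -> genus_is cone_rmorph g.
Proof. exact. Qed.

Lemma evaluation_code_cone m (P : 'I_m -> point X) (D : divisor X) x :
  geometric_RS_code P D x <-> evaluation_code cone_rmorph P D x.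
Proof. by []. Qed.

End ConeField.

Section ReedSolomon.
Variables (F : fieldExtType 'F_2) (K : closedFieldType) (iota : {rmorphism F -> K}).
Variables (X : variety iota) (g m : nat) (P : 'I_m -> point X) (D : divisor X).
Hypothesis hX : nonsingular_curve X.
Hypothesis hg : has_genus X g.
Hypothesis Pinj : injective P.
Hypothesis Prat : forall i, rational_point (P i).
Hypothesis Drat : rational_divisor D.
Hypothesis disj : forall i, coeff (P i) D = 0.

Let cl := cone_rmorph X.
Let clK := @cone_rmorph_eq0 _ _ _ X.
Let hdim : dimension_is cl 1 := dimension_cone hX.1.
Let hparam Q : exists t, local_parameter cl Q t :=
  local_parameter_exists clK (hX.2 Q).
Let genus_cl : genus_is cl g := genus_cone hg.

Fact value_in_base Q phi c : rational_point Q -> rational cl phi ->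
  value_at cl Q phi c -> exists d, c = iota d.
Proof.
have [sigma [s_iota s_onto s_fixed]] := frobenius_exists iota.
exact: (value_at_rational clK s_iota s_onto s_fixed).
Qed.

Lemma RS_code_weight x : geometric_RS_code P D x -> x != 0 ->
  m%:Z - deg D <= #|[set i | x 0 i != 0]|%:Z.
Proof.
move=> /evaluation_code_cone.
exact: (evaluation_code_weight clK hdim hparam value_in_base genus_cl Pinj Prat Drat disj).
Qed.

Lemma RS_code_separates (S : {set 'I_m}) i c : i \in S ->
  #|S|%:Z <= deg D - (2 * g)%:Z + 1 ->
  exists x, [/\ geometric_RS_code P D x, x 0 i = c
              & forall j, j \in S -> j != i -> x 0 j = 0].
Proof.
exact: (evaluation_code_separates clK hdim hparam value_in_base genus_cl Pinj Prat Drat disj).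
Qed.

Variables (s : nat) (e : s.-tuple F).
Hypothesis he : basis_of fullv e.
Let C2 := expanded_code e (geometric_RS_code P D).

Lemma mem_expanded x : geometric_RS_code P D x -> expand e x \in C2.
Proof. by move=> cx; rewrite inE; apply/asboolP; exists x. Qed.

(** The dual distance of the expanded code exceeds [deg D - 2 g + 1]: a codeword
    over [F] that is a basis element at one point, and zero at the other points
    with a bit in [T], has an expansion with a single nonzero bit in [T]. *)
Lemma expanded_strength (T : {set 'I_(m * s)}) : (0 < #|T|)%N ->
  #|T|%:Z <= deg D - (2 * g)%:Z + 1 ->
  exists2 z, z \in C2 & \sum_(k in T) z 0 k != 0.
Proof.
move=> /card_gt0P[k0 k0T] cardT.
have /choice[r rE] : forall k : 'I_(m * s), exists ij, k = mxvec_index ij.1 ij.2.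
  by move=> k; case/mxvec_indexP: k => i j; exists (i, j).
pose S := [set (r k).1 | k in T].
have [||x [cx xi xj]] := @RS_code_separates S (r k0).1 (tnth e (r k0).2).
- exact: imset_f.
- by apply: le_trans cardT; rewrite lez_nat; apply: leq_imset_card.
exists (expand e x); first exact: mem_expanded.
have free_e := basis_free he.
rewrite (bigD1 k0) //= big1 ?addr0 => [|k /andP[kT nk]].
  by rewrite [in expand _ _ _ _](rE k0) expandE xi (tnth_nth 0) coord_free // eqxx oner_eq0.
rewrite [in expand _ _ _ _](rE k) expandE.
have [e1|n1] := eqVneq (r k).1 (r k0).1; last first.
  by rewrite xj ?linear0 //; apply: imset_f.
rewrite e1 xi (tnth_nth 0) coord_free //; case: eqP => // e2.
by case/eqP: nk; rewrite (rE k) (rE k0) e1 e2.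
Qed.

End ReedSolomon.

Section BinaryLinearCodes.
Variables (n : nat) (C : {set 'rV['F_2]_n}).
Hypothesis hC : has_good_generator_matrix C.

Lemma good_code0 : 0 \in C.
Proof. by case: hC => k [G [_ _ memC]]; rewrite memC sub0mx. Qed.

Lemma good_codeD x y : x \in C -> y \in C -> x + y \in C.
Proof. by case: hC => k [G [_ _ memC]]; rewrite !memC; apply: addmx_sub. Qed.

Lemma good_code_coord j : exists2 z, z \in C & z 0 j != 0.
Proof.
case: hC => k [G [_ nzG memC]]; have /cV0Pn[i hi] := nzG j.
by exists (row i G); rewrite ?memC ?row_sub // mxE; rewrite mxE in hi.
Qed.

(** A nonzero dual word of weight one or two is a zero column or a pair of equal
    columns of a generator matrix. *)
Lemma distinct_strength2 (T : {set 'I_n}) : distinct_coordinates C ->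
  (0 < #|T| <= 2)%N -> exists2 z, z \in C & \sum_(j in T) z 0 j != 0.
Proof.
move=> dC /andP[T0 T2]; have /orP[/cards1P[j ->]|/cards2P[i [j [ij ->]]]] :
    (#|T| == 1)%N || (#|T| == 2)%N by case: #|T| T0 T2 => [|[|[|k]]].
  by have [z zC zj] := good_code_coord j; exists z; rewrite // big_set1.
have [z zC zij] := dC i j ij; exists z => //; rewrite big_setU1 ?inE //= big_set1.
by move: zij; case: (z 0 i) => -[|[|//]] ?; case: (z 0 j) => -[|[|//]] ?.
Qed.

Lemma min_distance_exists : (exists2 x, x \in C & x != 0) -> exists d, is_min_distance C d.
Proof.
case=> x0 x0C nx0.
pose D d := [exists x in C, (x != 0) && (weight x == d)].
have exD : exists d, D d by exists (weight x0); apply/exists_inP; exists x0; rewrite ?nx0 /=.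
case: (ex_minnP exD) => d /exists_inP[x xC /andP[nx /eqP wx]] dmin.
exists d; split=> [|y yC ny]; first by exists x.
by apply: dmin; apply/exists_inP; exists y; rewrite ?ny /=.
Qed.

End BinaryLinearCodes.

Theorem corollary4p5
  (R : realType) (s : nat)
  (* the field with q = 2^s elements, and a basis of it over 'F_2 *)
  (F : fieldExtType 'F_2) (e : s.-tuple F) (he : basis_of fullv e)
  (* an algebraic closure of F *)
  (K : closedFieldType) (iota : {rmorphism F -> K}) (hK : integralRange iota)
  (X : variety iota) (hX : nonsingular_curve X) (g : nat) (hg : has_genus X g)
  (m : nat) (hm : (0 < m)%N) (P : 'I_m -> point X) (hPinj : injective P)
  (hPrat : forall i, rational_point (P i))
  (D' : divisor X) (hDrat : rational_divisor D')
  (hdisj : forall i, coeff (P i) D' = 0)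
  (hdeg_lb : (2 * g)%:Z - 2 < deg D') (hdeg_ub : deg D' < m%:Z)
  (C2 := expanded_code e (geometric_RS_code P D'))
  (hC2 : has_good_generator_matrix C2) :
  (exists d : nat, is_min_distance C2 d /\ m%:Z - deg D' <= d%:Z) /\
  ((deg D' <= (2 * g)%:Z -> distinct_coordinates C2) ->
   exists (l : nat) (psi : R -> 'rV['F_2]_(m * s) -> 'rV['F_2]_(m * s)),
     [/\ forall eps : R, 0 < eps -> eps < 2^-1 ->
           is_approx_ML_decoding C2 l eps (psi eps),
         deg D' - (2 * g)%:Z + 1 <= l%:Z
       & forall (u : 'rV[R]_(m * s)) (i : 'I_(m * s)),
           truncated_map C2 l u 0 i =
             u 0 i + taylor_term C2 l (u - center R (m * s)) 0 i]).
Proof.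
split.
  pose k0 := mxvec_index (Ordinal hm) (Ordinal (basis_length_gt0 he)).
  have [|d dmin] := min_distance_exists (C := C2).
    have [z zC zk] := good_code_coord hC2 k0; exists z => //.
    by apply: contraNneq zk => ->; rewrite mxE.
  exists d; split=> //; have [[y [yC ny <-]] _] := dmin.
  move: yC ny; rewrite inE => /asboolP[x cx ->] ny.
  have nx : x != 0 by apply: contraNneq ny => ->; rewrite expand0.
  apply: le_trans (RS_code_weight hX hg hPinj hPrat hDrat hdisj cx nx) _.
  by rewrite lez_nat; exact: weight_expand.
move=> hdist; pose l := maxn 2 (absz (deg D' - (2 * g)%:Z + 1)).
(* order at least 2, so that the linear part of the expansion stays separate *)
exists l, (fun eps y => \row_i
  (if 2^-1 <= truncated_map C2 l (channel_input eps y) 0 i then 1 else 0)).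
split=> [eps _ _ y i||u i]; first by rewrite mxE.
  by rewrite /l; move: (deg D') => x; lia.
apply: (truncated_mapE (good_code0 hC2) (good_codeD hC2)); last exact: leq_maxl.
move=> T /andP[T0 Tl].
have [small|large] := leP (deg D') (2 * g)%:Z.
  apply: (distinct_strength2 hC2 (hdist small)); rewrite T0 /=.
  by move: Tl small hdeg_lb; rewrite /l; move: (deg D') #|T| => x c; lia.
apply: (expanded_strength hX hg hPinj hPrat hDrat hdisj he T0).
by move: Tl large; rewrite /l; move: (deg D') #|T| => x c; lia.
Qed.
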